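(* Let $\Sigma\subset\mathbb R^2$ be a damping set, $p\in[1,+\infty]$, and $S:\mathbb R\rightrightarrows\mathbb R$ be the set-valued map whose graph is $R\Sigma$. Then the wave equation associated with $\Sigma$ is GES in $\mathsf X_p$ if and only if there exist $\mu\in(0,1)$ and an integer $n_0\ge1$ such that, for every $x\in\mathbb R$, one has $\|S^{[n_0]}(x)\|\le\mu|x|$.
   Context: Notation: $\mathbb R_+=[0,+\infty)$, $R=\begin{pmatrix}\frac1{\sqrt2}&\frac1{\sqrt2}\\-\frac1{\sqrt2}&\frac1{\sqrt2}\end{pmatrix}$ and $R\Sigma=\{R\xi:\xi\in\Sigma\}$. The graph of $S$ is $\{(x,y):y\in S(x)\}$; $y\in S^{[n]}(x)$ iff there exist $x_0=x,x_1,\dots,x_n=y$ with $x_{i+1}\in S(x_i)$ for $0\le i\le n-1$. For $A\subset\mathbb R$, $\|A\|=\sup_{a\in A}|a|$. $L^p_{\mathrm{loc}}(a,+\infty)$ is the set of measurable functions whose restriction to $(a,T)$ is in $L^p$ for every $T>a$. $W^{1,p}_*(0,1)=\{u\in L^p(0,1): u'\in L^p(0,1),\ u(0)=0\}$ and $\mathsf X_p=W^{1,p}_*(0,1)\times L^p(0,1)$, with norm $\|(u,v)\|_{\mathsf X_p}^p=2^{-p/2}\int_0^1(|u'+v|^p+|u'-v|^p)\,dx$ if $p<+\infty$ and $\|(u,v)\|_{\mathsf X_\infty}=\frac1{\sqrt2}\max(\|u'+v\|_{L^\infty(0,1)},\|u'-v\|_{L^\infty(0,1)})$. The wave equation associated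 with $\Sigma$ is: $z_{tt}=z_{xx}$ on $\mathbb R_+\times[0,1]$; $z(t,0)=0$ and $(z_t(t,1),-z_x(t,1))\in\Sigma$ for $t\in\mathbb R_+$; $z(0,x)=z_0(x)$, $z_t(0,x)=z_1(x)$ for $x\in[0,1]$. A (weak, global in time) solution in $\mathsf X_p$ with initial condition $(z_0,z_1)\in\mathsf X_p$ is a function $z:\mathbb R_+\times[0,1]\to\mathbb R$ for which there exist $f\in L^p_{\mathrm{loc}}(0,+\infty)$ and $g\in L^p_{\mathrm{loc}}(-1,+\infty)$ such that $z(t,x)=\frac1{\sqrt2}\int_0^{t+x}f+\frac1{\sqrt2}\int_0^{t-x}g$ for all $(t,x)\in\mathbb R_+\times[0,1]$, $z(t,0)=0$ and $(z_t(t,1),-z_x(t,1))\in\Sigma$ for a.e. $t\in\mathbb R_+$, and $z(0,x)=z_0(x)$, $z_t(0,x)=z_1(x)$ for a.e. $x\in[0,1]$; here $z_t(t,x)=\frac{f(t+x)+g(t-x)}{\sqrt2}$ and $z_x(t,x)=\frac{f(t+x)-g(t-x)}{\sqrt2}$. Set $e_p(z)(t)=\|(z(t,\cdot),z_t(t,\cdot))\|_{\mathsf X_p}$. Damping set: $\Sigma$ is a damping set if $(0,0)\in\Sigma$, $xy\ge0$ for every $(x,y)\in\Sigma$, and $R\Sigma$ contains the graph of a universally measurable function $\varphi:\mathbb R\to\mathbb R$ with linear growth ($|\varphi(x)|\le a|x|+b$ for some $a,b\ge0$). A set $M\subset\mathbb R$ is universally measurable if for every Borel probability measure $\nu$ on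 $\mathbb R$ there exist Borel sets $A\subset M\subset B$ with $\nu(B\setminus A)=0$; $\varphi$ is universally measurable if preimages of Borel sets are universally measurable. GES: the wave equation is GES (globally exponentially stable) in $\mathsf X_p$ if there exist positive constants $C_1,C_2$ such that $e_p(z)(t)\le C_1e^{-C_2t}e_p(z)(0)$ for all $t\ge0$ and every solution $z$ in $\mathsf X_p$. *)

(* Defs.v *)
From mathcomp Require Import all_boot all_order all_algebra.
From mathcomp Require Import all_classical all_reals all_analysis.

Set Implicit Arguments.
Unset Strict Implicit.
Unset Printing Implicit Defensive.
Import Order.TTheory GRing.Theory Num.Theory.
Import numFieldNormedType.Exports.
Local Open Scope classical_set_scope.
Local Open Scope ring_scope.

(* Functions defined on a part of the real line are represented by total
   functions R -> R whose values outside that part are never used.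
   [lebesgue_measure] lives on the Borel sigma-algebra, and "measurable" means
   Borel measurable; since every Lebesgue measurable function is a.e. equal to
   a Borel one, this changes none of the L^p classes. *)

Section SetValuedMaps.
Context {R : realType}.

(* Rotation by the matrix ((1, 1), (-1, 1)) / sqrt 2. *)
Definition rotation (xi : R * R) : R * R :=
  ((xi.1 + xi.2) / Num.sqrt 2, (xi.2 - xi.1) / Num.sqrt 2).

Definition svmap_graph (S : R -> set R) : set (R * R) :=
  [set xy | S xy.1 xy.2].

Definition svmap_iter (S : R -> set R) (n : nat) (x : R) : set R :=
  [set y | exists s : nat -> R,
    [/\ s 0%N = x, s n = y & forall i, (i < n)%N -> S (s i) (s i.+1)]].

(* With values in the extended reals; it is only ever bounded from above, so
   the value -oo for the empty set plays the same role as 0. *)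
Definition set_norm (A : set R) : \bar R := ereal_sup [set `|a|%:E | a in A].

Definition universally_measurable (M : set R) : Prop :=
  forall nu : probability R R, exists A B : set R,
    [/\ measurable A, measurable B, A `<=` M, M `<=` B & nu (B `\` A) = 0%E].

Definition universally_measurable_fun (phi : R -> R) : Prop :=
  forall Y : set R, measurable Y -> universally_measurable (phi @^-1` Y).

Definition linear_growth (phi : R -> R) : Prop :=
  exists a b : R, [/\ 0 <= a, 0 <= b & forall x, `|phi x| <= a * `|x| + b].

Definition damping_set (Sigma : set (R * R)) : Prop :=
  [/\ Sigma (0, 0),
      forall xy, Sigma xy -> 0 <= xy.1 * xy.2 &
      exists phi : R -> R,
        [/\ universally_measurable_fun phi, linear_growth phi &
            forall x, (rotation @` Sigma) (x, phi x)]].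

End SetValuedMaps.

Section FunctionSpaces.
Context {R : realType}.
Notation mu := (@lebesgue_measure R).

Definition Lp (p : \bar R) (D : set R) (f : R -> R) : Prop :=
  f \_ D \in Lfun mu p.

Definition Lploc (p : \bar R) (a : R) (f : R -> R) : Prop :=
  measurable_fun (`]a, +oo[ : set R) f /\
  forall T, a < T -> Lp p `]a, T[ f.

(* Functions in C^1_c(0, 1), extended by 0. *)
Definition test_fun (phi : R -> R) : Prop :=
  [/\ forall x, derivable phi x 1, continuous (derive1 phi) &
      exists a b, [/\ 0 < a, b < 1 & forall x, x \notin `[a, b] -> phi x = 0]].

Definition is_weak_deriv (u w : R -> R) : Prop :=
  [/\ locally_integrable (`]0, 1[ : set R) u,
      locally_integrable (`]0, 1[ : set R) w &
      forall phi, test_fun phi ->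
        \int[mu]_(x in `]0, 1[) (u x * derive1 phi x) =
        - \int[mu]_(x in `]0, 1[) (w x * phi x)].

(* A chosen weak derivative on (0, 1); it is unique up to a null set. *)
Definition weak_deriv (u : R -> R) : R -> R :=
  xget (fun=> 0) [set w | is_weak_deriv u w].

(* Elements of W^{1,p}(0, 1) are represented by their continuous
   representative on [0, 1], which gives its meaning to u(0) = 0. *)
Definition W1p_star (p : \bar R) (u : R -> R) : Prop :=
  [/\ Lp p `]0, 1[ u,
      exists w, is_weak_deriv u w /\ Lp p `]0, 1[ w,
      {within `[0, 1], continuous u} &
      u 0 = 0].

Definition Xp (p : \bar R) (uv : (R -> R) * (R -> R)) : Prop :=
  W1p_star p uv.1 /\ Lp p `]0, 1[ uv.2.

(* The case -oo is irrelevant, as p is always at least 1. *)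
Definition Xp_norm (p : \bar R) (uv : (R -> R) * (R -> R)) : \bar R :=
  let du := weak_deriv uv.1 in
  let v := uv.2 in
  match p with
  | r%:E%E => (((2 `^ (- (r / 2)))%R%:E *
        \int[mu]_(x in `]0%R, 1%R[)
          (`|du x + v x| `^ r + `|du x - v x| `^ r)%R%:E) `^ (r^-1)%R)%E
  | +oo%E => (((Num.sqrt 2)^-1)%R%:E *
        maxe ('N[mu]_+oo[EFin \o ((du \+ v)%R \_ `]0%R, 1%R[)])
             ('N[mu]_+oo[EFin \o ((du \- v)%R \_ `]0%R, 1%R[)]))%E
  | -oo%E => 0%E
  end.

End FunctionSpaces.

Section WaveEquation.
Context {R : realType}.
Notation mu := (@lebesgue_measure R).

(* The oriented integral of h from 0 to s, where s may be negative. *)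
Definition primitive0 (h : R -> R) (s : R) : R :=
  if 0 <= s then \int[mu]_(x in `[0, s]) h x
  else - \int[mu]_(x in `[s, 0]) h x.

Definition wave_t (f g : R -> R) (t x : R) : R :=
  (f (t + x) + g (t - x)) / Num.sqrt 2.

Definition wave_x (f g : R -> R) (t x : R) : R :=
  (f (t + x) - g (t - x)) / Num.sqrt 2.

(* z is a solution in X_p with initial condition (z0, z1), as witnessed by f
   and g; these are determined by z up to null sets, so that the functions
   [wave_t f g] and [wave_x f g] are "the" partial derivatives of z. *)
Definition wave_solution_by (Sigma : set (R * R)) (p : \bar R)
    (z0 z1 : R -> R) (z : R -> R -> R) (f g : R -> R) : Prop :=
  [/\ Lploc p 0 f /\ Lploc p (-1) g,
      forall t x, 0 <= t -> 0 <= x <= 1 ->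
        z t x = (Num.sqrt 2)^-1 * primitive0 f (t + x) +
                (Num.sqrt 2)^-1 * primitive0 g (t - x),
      {ae mu, forall t : R, 0 <= t ->
        z t 0 = 0 /\ Sigma (wave_t f g t 1, - wave_x f g t 1)} &
      {ae mu, forall x : R, 0 <= x <= 1 ->
        z 0 x = z0 x /\ wave_t f g 0 x = z1 x}].

Definition energy (p : \bar R) (z : R -> R -> R) (f g : R -> R) (t : R)
    : \bar R :=
  Xp_norm p (z t, wave_t f g t).

Definition GES (Sigma : set (R * R)) (p : \bar R) : Prop :=
  exists C1 C2 : R, [/\ 0 < C1, 0 < C2 &
    forall (z0 z1 : R -> R) (z : R -> R -> R) (f g : R -> R),
      Xp p (z0, z1) -> wave_solution_by Sigma p z0 z1 z f g ->
      forall t, 0 <= t ->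
        (energy p z f g t <= (C1 * expR (- C2 * t))%:E * energy p z f g 0)%E].

End WaveEquation.

(* Main.v *)
From HB Require Import structures.
Require Import Defs.
From mathcomp Require Import all_boot all_order all_algebra.
From mathcomp Require Import all_classical all_reals all_analysis.
From mathcomp Require Import measurable_realfun ess_sup_inf ring lra.
Import Order.TTheory GRing.Theory Num.Theory.
Import numFieldNormedType.Exports.
Local Open Scope classical_set_scope.
Local Open Scope ring_scope.
Set Implicit Arguments.
Unset Strict Implicit.
Unset Printing Implicit Defensive.

(** A solution is the superposition of a wave [f (t + x)] and a wave
    [g (t - x)], and everything can be read on [g] alone.

    The condition [z t 0 = 0] says that the primitive of [f + g] from [0]
    vanishes, so that [f = - g] almost everywhere on the positive half-line
    ([dirichlet_reflection]).  At the other end, the rotation sends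
    [(z_t, - z_x)] to [(g (t - 1), - f (t + 1))] ([rotation_wave]), so that the
    boundary law becomes the inclusion [g (s + 2) \in S (g s)] for almost every
    [s > -1] ([wave_recursion]): a solution is a measurable family of orbits of
    [S], indexed by [s] in (-1, 1).  Moreover [z_x + z_t] and [z_x - z_t] are
    [sqrt 2 * f (t + x)] and [- sqrt 2 * g (t - x)], so that the energy at time
    [t] is the L^p norm of [g] on the window (t - 1, t + 1) ([energy_finE] and
    [energy_pinfty_le]).  Since the energy is defined with a chosen weak
    derivative of [z t], this requires that weak derivatives be unique almost
    everywhere ([weak_deriv_ae]) and that a primitive have its integrand as a
    weak derivative ([is_weak_deriv_primitive], by Fubini's theorem).

    Sufficiency.  Damping means that [|y| <= |x|] whenever [y \in S x]
    ([damping_svmap_le]); with the contraction of the [n]-th iterate, an orbit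
    satisfies [|a_k| <= m ^ (k / n) * |a_0|] with the quotient rounded down
    ([orbit_contraction]).  The window of time [t] is covered by two consecutive
    translates of (-1, 1) by even integers, on each of which [g] is dominated
    pointwise by its values on (-1, 1), and the energy decays geometrically
    ([energy_decay], [GES_of_contraction]).

    Necessity.  Every orbit is carried by a solution: let [g] be constant, equal
    to [a_k], on [2k - 1, 2k + 1[ and put [f = - g] ([step_wave_solution]).  Its
    energy at time [2k] is proportional to [|a_k|], with a factor that depends
    on [p] only.  An orbit of length [n] issued from [x] is continued for ever
    with the selection [phi] of [S], and the decay estimate at time [2n], for
    [n] so large that [m = C1 * exp (- 2 * C2 * n) < 1], reads
    [|a_n| <= m * |x|] ([step_energy_le], [contraction_of_GES]). *)

(** * Almost-everywhere statements and isometric changes of variable *)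

Section MeasurePreserving.
Context {R : realType}.
Notation mu := (@lebesgue_measure R).

Lemma ae_imp {P Q : R -> Prop} : {ae mu, forall x, P x} ->
  (forall x, P x -> Q x) -> {ae mu, forall x, Q x}.
Proof.
move=> aeP PQ; move: aeP; apply: filterS => //.
exact: (ae_filter_ringOfSetsType mu).
Qed.

Lemma ae_imp2 {P Q P' : R -> Prop} : {ae mu, forall x, P x} ->
  {ae mu, forall x, P' x} ->
  (forall x, P x -> P' x -> Q x) -> {ae mu, forall x, Q x}.
Proof.
move=> aeP aeP' PQ; move: aeP aeP'; apply: filterS2 => //.
exact: (ae_filter_ringOfSetsType mu).
Qed.

Lemma ae_neq (c : R) : {ae mu, forall x, x != c}.
Proof.
exists [set c]; split => //; first by rewrite lebesgue_measure_set1.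
by move=> x /= /negP; rewrite negbK => /eqP.
Qed.

Definition lebesgue_preserving (h : R -> R) : Prop :=
  measurable_fun setT h /\ forall A, measurable A -> mu (h @^-1` A) = mu A.

(** Translations preserve the length of half-open intervals, and a measure on the
    Borel sets is determined by these lengths. *)
Lemma lebesgue_preserving_shift (c : R) :
  lebesgue_preserving (fun x => c + x).
Proof.
have mh : measurable_fun setT (fun x : measurableTypeR R => c + x : measurableTypeR R).
  exact: measurable_funD.
split => // A mA.
pose h : {mfun measurableTypeR R >-> measurableTypeR R} :=
  HB.pack (fun x : measurableTypeR R => c + x : measurableTypeR R)
    (isMeasurableFun.Build _ _ _ _ _ mh).
apply/esym; apply: (@lebesgue_measure_unique R (pushforward mu h)) => // _ [[a b]] _ <-.
transitivity (mu `]a - c, b - c]%classic); last first.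
  congr (mu _).
  by apply/seteqP; split => x /=; rewrite !in_itv/= ltrBlDl lerBrDl.
rewrite /= !lebesgue_measure_itv/= !lte_fin ltrD2r -!EFinB.
by case: ifP => // _; congr EFin; ring.
Qed.

Lemma lebesgue_preserving_refl (c : R) :
  lebesgue_preserving (fun x => c - x).
Proof.
split; first exact: measurable_funB.
move=> A mA.
have [mh hA] := lebesgue_preserving_shift c.
have -> : (fun x => c - x) @^-1` A = -%R @^-1` ((fun x => c + x) @^-1` A) by [].
rewrite -(hA A mA) -[RHS]lebesgue_measureN//.
by rewrite -[X in measurable X]setTI; exact: mh.
Qed.

Lemma lebesgue_preserving_ae {h : R -> R} {P : R -> Prop} :
  lebesgue_preserving h -> {ae mu, forall y, P y} -> {ae mu, forall x, P (h x)}.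
Proof.
move=> [mh hA] [N [mN N0 PN]].
exists (h @^-1` N); split; last by move=> x /= Px; apply: PN.
- by rewrite -[X in measurable X]setTI; exact: mh.
- by rewrite hA.
Qed.

Lemma lebesgue_preserving_ge0_integral {h : R -> R} D (f : R -> \bar R) :
  lebesgue_preserving h -> measurable D -> measurable_fun D f ->
  (forall y, D y -> 0 <= f y)%E ->
  (\int[mu]_(x in h @^-1` D) f (h x) = \int[mu]_(y in D) f y)%E.
Proof.
move=> [mh hA] mD mf f0.
pose h' : measurableTypeR R -> measurableTypeR R := h.
have mh' : measurable_fun setT h' by exact: mh.
pose hM : {mfun measurableTypeR R >-> measurableTypeR R} :=
  HB.pack h' (isMeasurableFun.Build _ _ _ _ _ mh').
transitivity (\int[pushforward mu h']_(y in D) f y)%E.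
  by rewrite (ge0_integral_pushforward mh')// => y; rewrite inE; exact: f0.
apply: (eq_measure_integral mu (m1 := pushforward mu hM)) => A mA _.
exact: hA.
Qed.

Lemma lebesgue_preserving_integrable {h : R -> R} D (f : R -> R) :
  lebesgue_preserving h -> measurable D -> mu.-integrable D (EFin \o f) ->
  mu.-integrable (h @^-1` D) (EFin \o (f \o h)).
Proof.
move=> hh mD /integrableP[mf foo].
have mhD : measurable (h @^-1` D).
  by rewrite -[X in measurable X]setTI; exact: hh.1.
apply/integrableP; split.
  apply/measurable_EFinP; apply: (measurable_comp mD) => //.
  - by move=> _ [x Dx <-].
  - exact/measurable_EFinP.
  - exact: measurable_funTS hh.1.
rewrite (@lebesgue_preserving_ge0_integral h D (fun y => `|(f y)%:E|)%E)//.
exact: measurableT_comp.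
Qed.

Lemma lebesgue_preserving_Rintegral {h : R -> R} D (f : R -> R) :
  lebesgue_preserving h -> measurable D -> mu.-integrable D (EFin \o f) ->
  \int[mu]_(x in h @^-1` D) f (h x) = \int[mu]_(y in D) f y.
Proof.
move=> hh mD intf; congr fine.
have mhD : measurable (h @^-1` D).
  by rewrite -[X in measurable X]setTI; exact: hh.1.
have /= -> := @integralE _ _ _ mu (h @^-1` D) (fun x => (f (h x))%:E).
rewrite [RHS]integralE; have mf := measurable_int mu intf.
rewrite -(lebesgue_preserving_ge0_integral hh mD)//; last exact: measurable_funepos.
rewrite -(lebesgue_preserving_ge0_integral hh mD)//; last first.
  exact: measurable_funeneg.
by congr (_ - _)%E; apply: eq_integral => x _; rewrite ?(funeposE, funenegE).
Qed.

End MeasurePreserving.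

(** * Weak derivatives on (0, 1) *)

Section WeakDerivative.
Context {R : realType}.
Notation mu := (@lebesgue_measure R).

(** The primitive is constant on the interval, and its derivative is almost
    everywhere the integrand by Lebesgue's differentiation theorem. *)
Lemma ae_eq0_of_primitive_eq0 (a b : R) (h : R -> R) :
  mu.-integrable `]a, b[ (EFin \o h) ->
  (forall x, a < x < b -> \int[mu]_(y in `]a, x]) h y = 0) ->
  {ae mu, forall x, a < x < b -> h x = 0}.
Proof.
move=> ih h0; pose H := h \_ `]a, b[.
have iH : mu.-integrable setT (EFin \o H).
  by rewrite /H -restrict_EFin -integrable_mkcond.
have iHy y : mu.-integrable [set` Interval (BRight a) (BRight y)] (EFin \o H).
  exact: integrableS iH.
have lH : locally_integrable setT H by apply: open_integrable_locally => //; exact: openT.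
have /= := FTC1 iHy lH.
apply: filterS; first exact: (ae_filter_ringOfSetsType mu).
move=> x + /andP[ax xb].
move=> /(_ _)[|_]; first by rewrite lte_fin.
have -> : H x = h x by rewrite /H patchE mem_set//= in_itv/= ax xb.
move=> <-; rewrite derive1E.
rewrite (near_eq_derive (g := cst 0)) ?derive_cst//.
have : x \in `]a, b[ by rewrite in_itv/= ax xb.
move=> /near_in_itvoo; apply: filterS => y; rewrite in_itv/= => /andP[ay yb].
rewrite -[RHS](h0 y) ?ay//; apply: eq_Rintegral => z.
rewrite inE/= in_itv/= => /andP[az zy].
by rewrite /H patchE mem_set//= in_itv/= az (le_lt_trans zy).
Qed.

Let pos2 (y : R) : R := Num.max 0 y ^+ 2.

(** The square of the positive part is a C^1 function that vanishes on a
    half-line: all test functions below are polynomials in it. *)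
Let is_derive_pos2 (y : R) : is_derive y 1 pos2 (2 * Num.max 0 y).
Proof.
have key : forall h, `|pos2 (y + h) - pos2 y - 2 * Num.max 0 y * h| <= h ^+ 2.
  move=> h; rewrite /pos2 ler_norml.
  by case: (leP 0 y) => y0; case: (leP 0 (y + h)) => yh0; nra.
have cv : h^-1 *: (pos2 (h *: 1 + y) - pos2 y) @[h --> 0^'] --> 2 * Num.max 0 y.
  apply/cvgrPdist_le => /= e e0; near=> h.
  have h0 : h != 0 by near: h; exact: nbhs_dnbhs_neq.
  have -> : h *: (1 : R) + y = y + h by rewrite -[h *: 1]/(h * 1) mulr1 addrC.
  rewrite -[h^-1 *: _]/(h^-1 * _) distrC.
  have -> : h^-1 * (pos2 (y + h) - pos2 y) - 2 * Num.max 0 y =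
    h^-1 * (pos2 (y + h) - pos2 y - 2 * Num.max 0 y * h) by field.
  rewrite normrM normfV; apply: (@le_trans _ _ `|h|).
    rewrite ler_pdivrMl ?normr_gt0// (le_trans (key h))//.
    by rewrite -normrM -expr2 ler_norm.
  by near: h; exact: dnbhs0_le.
apply: DeriveDef; first by apply/cvg_ex; eexists; exact: cv.
by apply: cvg_lim => //; exact: cv.
Unshelve. all: by end_near. Qed.

(** For [0 <= a <= b <= 1], these functions take values between 0 and 1 and
    increase to the indicator of the open interval from [a] to [b] as [n] tends to
    infinity, because [(1 - q) ^ n] tends to [0] when [0 < q <= 1]. *)
Definition bump (a b : R) (n : nat) (x : R) : R :=
  1 - (1 - pos2 ((x - a) * (b - x))) ^+ n.+1.

Lemma bump_eq0 (a b : R) n x : a <= b -> x \notin `]a, b[ -> bump a b n x = 0.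
Proof.
move=> ab; rewrite in_itv/= negb_and -!leNgt /bump /pos2 => xab.
suff -> : Num.max 0 ((x - a) * (b - x)) = 0.
  by rewrite expr0n/= subr0 expr1n subrr.
apply/max_idPl; case/orP: xab => h.
  by rewrite mulr_le0_ge0// ?subr_le0 ?subr_ge0// (le_trans h).
by rewrite mulr_ge0_le0// ?subr_le0 ?subr_ge0// (le_trans ab).
Qed.

Lemma test_fun_bump (a b : R) (n : nat) : 0 < a -> a <= b -> b < 1 ->
  test_fun (bump a b n).
Proof.
move=> a0 ab b1.
pose q := fun x : R => (x - a) * (b - x).
pose dq := fun x : R => a + b - 2 * x.
pose d1 := fun x : R => (n.+1%:R * (1 - pos2 (q x)) ^+ n) * (2 * Num.max 0 (q x) * dq x).
have dq1 (x : R) : is_derive x 1 q (dq x).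
  have -> : q = (id - cst a) * (cst b - id) by [].
  apply: is_derive_eq; rewrite /dq !fctE /GRing.scale/=; ring.
have dpq (x : R) : is_derive x 1 (pos2 \o q) (2 * Num.max 0 (q x) * dq x).
  exact: is_derive1_comp.
have db (x : R) : is_derive x 1 (bump a b n) (d1 x).
  have -> : bump a b n = cst 1 - (cst 1 - (pos2 \o q)) ^+ n.+1.
    by apply/funext => y; rewrite /bump !fctE.
  apply: is_derive_eq; rewrite /d1 /= !fctE -![_ *: _]/(_ * _); ring.
split.
- by move=> x; have [] := db x.
- have -> : derive1 (bump a b n) = d1.
    by apply/funext => x; rewrite derive1E; exact: (@derive_val _ _ _ _ _ _ _ (db x)).
  have cdq : continuous dq.
    move=> x; apply: cvgB; first exact: cvg_cst.
    by apply: cvgM; [exact: cvg_cst|exact: cvg_id].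
  have cq : continuous q.
    move=> x; apply/differentiable_continuous/derivable1_diffP.
    exact: ex_derive.
  have cp : continuous pos2.
    move=> x; apply/differentiable_continuous/derivable1_diffP.
    exact: ex_derive.
  have cm : continuous (fun x => Num.max 0 (q x)).
    move=> x; apply: (@continuous_max _ _ (cst 0) q); [exact: cvg_cst|exact: cq].
  move=> x; apply: cvgM; apply: cvgM.
  - exact: cvg_cst.
  - apply: (@continuous_comp _ _ _ (fun y => 1 - pos2 (q y)) (fun y : R => y ^+ n));
      last exact: exprn_continuous.
    apply: cvgB; first exact: cvg_cst.
    by apply: continuous_comp; [exact: cq|exact: cp].
  - by apply: cvgM; [exact: cvg_cst|exact: cm].
  - exact: cdq.
- exists a, b; split=> // x.
  move=> xab; apply: bump_eq0 => //; apply: contra xab.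
  exact: subset_itv_oo_cc.
Qed.

Let bump_arg (a b x : R) : (x - a) * (b - x) <= (b - a) ^+ 2.
Proof. by have := sqr_ge0 (x - a); have := sqr_ge0 (b - x); nra. Qed.

Lemma bump_itv01 (a b : R) n x : 0 <= a -> a <= b -> b <= 1 -> 0 <= bump a b n x <= 1.
Proof.
move=> a0 ab b1; rewrite /bump /pos2; set p := Num.max _ _.
have p0 : 0 <= p by rewrite le_max lexx.
have p1 : p <= 1 by rewrite ge_max ler01/= (le_trans (bump_arg a b x))//; nra.
have r0 : 0 <= 1 - p ^+ 2 by nra.
have r1 : 1 - p ^+ 2 <= 1 by nra.
rewrite subr_ge0 exprn_ile1//= gerBl; exact: exprn_ge0.
Qed.

Lemma cvg_bump (a b : R) x : 0 <= a -> a <= b -> b <= 1 -> a < x < b ->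
  bump a b n x @[n --> \oo] --> (1 : R).
Proof.
move=> a0 ab b1 /andP[ax xb].
rewrite -[X in _ --> X]subr0; apply: cvgB; first exact: cvg_cst.
rewrite /pos2; set p := Num.max _ _.
have p0 : 0 < p by rewrite lt_max; apply/orP; right; rewrite mulr_gt0 ?subr_gt0.
have p1 : p <= 1 by rewrite ge_max ler01/= (le_trans (bump_arg a b x))//; nra.
rewrite (cvg_shiftS (fun n => (1 - p ^+ 2) ^+ n)).
by apply: cvg_expr; rewrite ger0_norm; nra.
Qed.

Lemma test_fun_continuous (phi : R -> R) : test_fun phi -> continuous phi.
Proof.
move=> [dphi _ _] x.
by apply/differentiable_continuous/derivable1_diffP; exact: dphi.
Qed.

Lemma test_fun_bounded (phi : R -> R) :
  test_fun phi -> exists M, forall x, `|phi x| <= M.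
Proof.
move=> tphi; have cphi := test_fun_continuous tphi.
have [_ _ [a [b [_ _ phi0]]]] := tphi.
have : bounded_set (phi @` `[a, b]).
  apply: compact_bounded; apply: continuous_compact (@segment_compact _ a b).
  exact: continuous_subspaceT.
move=> [M [_ bM]]; exists (`|M| + 1) => x.
have [xab|xab] := boolP (x \in `[a, b]); last by rewrite phi0// normr0.
by apply: (bM (`|M| + 1)); [rewrite ltr_pwDr// ler_norm|exists x].
Qed.

Lemma integrable_mul_test_fun (w phi : R -> R) :
  locally_integrable (`]0, 1[ : set R) w -> test_fun phi ->
  mu.-integrable `]0, 1[ (EFin \o (w \* phi)).
Proof.
move=> [mw _ iw] tphi.
have [M phiM] := test_fun_bounded tphi.
have mphi : measurable_fun setT phi.
  by apply: continuous_measurable_fun; exact: test_fun_continuous.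
have [_ _ [a [b [a0 b1 phi0]]]] := tphi.
have ab01 : `[a, b]%classic `<=` (`]0, 1[ : set R).
  by move=> x /=; rewrite !in_itv/= => /andP[ax xb]; rewrite (lt_le_trans a0)//= (le_lt_trans xb).
have iab : mu.-integrable `[a, b] (EFin \o (w \* phi)).
  have -> : EFin \o (w \* phi) = ((EFin \o w) \* (EFin \o phi))%E.
    by apply/funext => x.
  apply: integrableMl => //.
  - apply/integrableP; split; last by apply: iw => //; exact: segment_compact.
    by apply/measurable_EFinP; apply: measurable_funS mw.
  - exact: measurable_funTS.
  - exists M; split; first exact: num_real.
    by move=> N MN x _ /=; rewrite (le_trans (phiM x))// ltW.
apply: (@integrableS _ _ _ mu setT) => //.
have -> : EFin \o (w \* phi) = (EFin \o (w \* phi)) \_ `[a, b].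
  apply/funext => x; rewrite patchE; case: ifPn => // xab /=.
  by rewrite phi0 ?mulr0//; apply: contra xab => xab; rewrite inE.
by rewrite -integrable_mkcond.
Qed.

(** Fundamental lemma of the calculus of variations.  Testing against [bump] and
    passing to the limit by dominated convergence, the integral of [w] over
    every interval with closure in (0, 1) vanishes. *)
Lemma ae_eq0_of_test_fun (w : R -> R) :
  locally_integrable (`]0, 1[ : set R) w ->
  (forall phi, test_fun phi -> \int[mu]_(x in `]0, 1[) (w x * phi x) = 0) ->
  {ae mu, forall x, 0 < x < 1 -> w x = 0}.
Proof.
move=> lw wphi.
have [mw _ iw] := lw.
have iwab (a b : R) : 0 < a -> b < 1 -> mu.-integrable `]a, b[ (EFin \o w).
  move=> a0 b1; apply: (@integrableS _ _ _ mu `[a, b]) => //.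
    exact: subset_itv_oo_cc.
  have ab01 : `[a, b]%classic `<=` (`]0, 1[ : set R).
    by move=> x /=; rewrite !in_itv/= => /andP[ax xb]; rewrite (lt_le_trans a0)//= (le_lt_trans xb).
  apply/integrableP; split; last by apply: iw => //; exact: segment_compact.
  by apply/measurable_EFinP; apply: measurable_funS mw.
have w0 (a b : R) : 0 < a -> a < b -> b < 1 -> \int[mu]_(x in `]a, b[) w x = 0.
  move=> a0 ab b1; have iw' := iwab a b a0 b1.
  have cv : (\int[mu]_(x in `]a, b[) (w x * bump a b n x)%:E @[n --> \oo] -->
      \int[mu]_(x in `]a, b[) (w x)%:E)%E.
    apply: (@dominated_cvg _ _ _ mu `]a, b[%classic _ _ _ (fun x => `|(w x)%:E|%E)) => //.
    - move=> n; apply/measurable_EFinP; apply: measurable_funM.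
        by have /measurable_int/measurable_EFinP := iw'.
      apply: measurable_funTS.
      by apply: continuous_measurable_fun; apply/test_fun_continuous/test_fun_bump => //; exact: ltW.
    - move=> x /=; rewrite in_itv/= => xab.
      apply/cvg_EFin; first by apply: nearW.
      rewrite -[X in _ --> X]mulr1; apply: cvgM; first exact: cvg_cst.
      by apply: cvg_bump => //; exact: ltW.
    - exact: integrable_abse.
    - move=> n x _; rewrite /= lee_fin normrM ler_piMr//.
      have /andP[? ?] := @bump_itv01 a b n x (ltW a0) (ltW ab) (ltW b1).
      by rewrite ger0_norm.
  have c0 n : (\int[mu]_(x in `]a, b[) (w x * bump a b n x)%:E = 0)%E.
    have tb : test_fun (bump a b n) by apply: test_fun_bump => //; exact: ltW.
    have -> : (\int[mu]_(x in `]a, b[) (w x * bump a b n x)%:E =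
        \int[mu]_(x in `]0%R, 1%R[) (w x * bump a b n x)%:E)%E.
      rewrite integral_mkcond [RHS]integral_mkcond; congr (integral _ _ _).
      apply/funext => x; rewrite !patchE.
      have [xab|xab] := boolP (x \in `]a, b[%classic).
        rewrite ifT//; move: xab; rewrite !inE/= !in_itv/= => /andP[ax xb].
        by rewrite (lt_trans a0)//= (lt_trans xb).
      rewrite bump_eq0 ?mulr0 ?if_same//; first exact: ltW.
      by apply: contra xab => xab; rewrite inE.
    rewrite -[LHS]fineK; last first.
      exact: integrable_fin_num (integrable_mul_test_fun lw tb).
    by congr EFin; exact: wphi.
  have : (\int[mu]_(x in `]a, b[) (w x)%:E = 0)%E.
    rewrite -(cvg_lim _ cv)//; under eq_fun do rewrite c0.
    exact: lim_cst.
  by rewrite /Rintegral => ->.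
have aek (k : nat) : {ae mu, forall x, k.+1%:R^-1 < x < 1 - k.+1%:R^-1 -> w x = 0}.
  have k0 : 0 < k.+1%:R^-1 :> R by rewrite invr_gt0.
  have k1 : 1 - k.+1%:R^-1 < 1 :> R by rewrite gtrBl.
  apply: ae_eq0_of_primitive_eq0; first exact: iwab.
  move=> x /andP[ax xb]; rewrite -Rintegral_itv_bndo_bndc.
    by apply: w0 => //; exact: lt_trans xb k1.
  by apply: iwab => //; exact: lt_trans xb k1.
have := ae_foralln aek; apply: filterS.
move=> x wx /andP[x0 x1].
have : 0 < Num.min x (1 - x) by rewrite lt_min x0 subr_gt0.
move=> /ltr_add_invr[k]; rewrite add0r lt_min => /andP[kx kx1].
by apply: (wx k); rewrite kx ltrBrDr -ltrBrDl.
Qed.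

(** Uniqueness of weak derivatives, for the one chosen by [weak_deriv]. *)
Lemma weak_deriv_ae (u w : R -> R) : is_weak_deriv u w ->
  locally_integrable (`]0, 1[ : set R) (weak_deriv u) /\
  {ae mu, forall x, 0 < x < 1 -> weak_deriv u x = w x}.
Proof.
move=> uw; have [_ lw phiw] := uw.
have [_ lv phiv] : is_weak_deriv u (weak_deriv u).
  by rewrite /weak_deriv; case: xgetP => [v _ //|/(_ w)].
split => //.
have : {ae mu, forall x, 0 < x < 1 -> (weak_deriv u \- w) x = 0}.
  apply: ae_eq0_of_test_fun; first exact: locally_integrableB.
  move=> phi tphi.
  under eq_Rintegral do rewrite /= mulrBl.
  rewrite RintegralB//; try exact: integrable_mul_test_fun.
  by apply/eqP; rewrite subr_eq0 -eqr_opp -phiv// phiw.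
apply: filterS; first exact: (ae_filter_ringOfSetsType mu).
by move=> x wx /wx /= /eqP; rewrite subr_eq0 => /eqP.
Qed.

End WeakDerivative.

Section Primitive.
Context {R : realType}.
Notation mu := (@lebesgue_measure R).

(** Legitimates Fubini's theorem for the integration by parts below. *)
Let integrable_prod_lt (F W : R -> R) :
  mu.-integrable setT (EFin \o F) -> mu.-integrable setT (EFin \o W) ->
  (mu \x mu)%E.-integrable setT
    (fun xy => (F xy.1 * (W xy.2 * ((xy.2 : R) < xy.1)%R%:R))%:E).
Proof.
move=> iF iW.
have mF : measurable_fun setT F by apply/measurable_EFinP; exact: measurable_int iF.
have mW : measurable_fun setT W by apply/measurable_EFinP; exact: measurable_int iW.
have mlt : measurable [set xy : measurableTypeR R * measurableTypeR R | ((xy.2 : R) < xy.1)%R].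
  rewrite -[X in measurable X]setTI.
  have : measurable_fun setT (fun xy : measurableTypeR R * measurableTypeR R => (xy.2 : R) < xy.1).
    exact: measurable_fun_ltr.
  exact: (fun h => h measurableT [set true] I).
have mk : measurable_fun setT
    (fun xy : measurableTypeR R * measurableTypeR R =>
      (F xy.1 * (W xy.2 * ((xy.2 : R) < xy.1)%R%:R))%:E).
  apply/measurable_EFinP; apply: measurable_funM.
    by apply: measurableT_comp => //; exact: measurable_fst.
  apply: measurable_funM.
    by apply: measurableT_comp => //; exact: measurable_snd.
  have -> : (fun xy : measurableTypeR R * measurableTypeR R => ((xy.2 : R) < xy.1)%R%:R : R) =
      \1_[set xy | ((xy.2 : R) < xy.1)%R].
    apply/funext => xy; rewrite indicE.
    have [h|h] := boolP ((xy.2 : R) < xy.1)%R; first by rewrite mem_set.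
    by rewrite memNset//; exact/negP.
  exact: measurable_indic.
apply/integrable12ltyP => //.
have [_ Foo] := integrableP _ _ _ iF.
have [_ Woo] := integrableP _ _ _ iW.
apply: (@le_lt_trans _ _ (\int[mu]_x (`|(F x)%:E| * \int[mu]_y `|(W y)%:E|))%E).
  apply: ge0_le_integral => //.
  - by move=> x _; exact: integral_ge0.
  - apply: (@measurable_fun_fubini_tonelli_F _ _ _ _ _ mu (fun xy =>
      `|(F xy.1 * (W xy.2 * ((xy.2 : R) < xy.1)%R%:R))%:E|%E)) => //.
    exact: measurableT_comp.
  - by apply: emeasurable_funM => //; do 2 apply: measurableT_comp => //.
  - move=> x _; rewrite -ge0_integralZl//; last by do 2 apply: measurableT_comp => //.
    apply: ge0_le_integral => //.
    + apply: measurableT_comp => //.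
      exact: (measurable_comp measurableT _ mk (measurable_pair1 x)).
    + by apply: emeasurable_funM => //; do 2 apply: measurableT_comp => //.
    + move=> y _; rewrite -abseM -EFinM /= lee_fin !normrM ler_wpM2l//.
      by rewrite ler_piMr//; case: (_ < _); rewrite ?normr1 ?normr0.
rewrite ge0_integralZr//; last 2 first.
  by do 2 apply: measurableT_comp => //.
  exact: integral_ge0.
apply: lte_mul_pinfty => //; first exact: integral_ge0.
by rewrite ge0_fin_numE//; exact: integral_ge0.
Qed.

Let integralZ_patch (D : set R) (h : R -> R) (k : R) :
  measurable D -> mu.-integrable D (EFin \o h) ->
  (\int[mu]_y (k * (h \_ D) y)%:E = (k * \int[mu]_(y in D) h y)%:E)%E.
Proof.
move=> mD ih; have ihD : mu.-integrable setT (EFin \o (h \_ D)).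
  by rewrite -restrict_EFin -integrable_mkcond.
under eq_integral do rewrite EFinM.
rewrite integralZl//= EFinM Rintegral_mkcond; congr (_ * _)%E.
by rewrite /Rintegral fineK//; exact: integrable_fin_num.
Qed.

Lemma continuous_primitive (T : R) (h : R -> R) : 0 <= T ->
  mu.-integrable `]0, T[ (EFin \o h) ->
  exists2 V, {within `[0, T], continuous V} &
    forall x, 0 < x < T -> V x = \int[mu]_(y in `]0, x[) h y.
Proof.
move=> T0 ih; pose H := h \_ `]0, T[.
have iH : mu.-integrable setT (EFin \o H).
  by rewrite /H -restrict_EFin -integrable_mkcond.
exists (fun x => \int[mu]_(y in `[0, x]) H y).
  by apply: parameterized_integral_continuous => //; exact: integrableS iH.
move=> x /andP[x0 xT]; rewrite [RHS]Rintegral_itv_bndo_bndc; last first.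
  apply: integrableS ih => // y /=; rewrite !in_itv/= => /andP[-> yx].
  exact: lt_trans yx xT.
rewrite [LHS]Rintegral_mkcond [RHS]Rintegral_mkcond; congr (Rintegral _ _ _).
apply/funext => y; rewrite !patchE /H patchE !mem_setE !in_itv/=.
case: (ltP 0 y) => y0 /=; last by rewrite if_same.
by rewrite (ltW y0)/=; case: (leP y x) => yx //=; rewrite (le_lt_trans yx xT).
Qed.

(** Integration by parts for a merely integrable [w]: by Fubini's theorem, the
    integrals of [w y * phi' x] over the triangle [y < x] computed in the two
    orders are that of [(u - c) * phi'] and that of [- w * phi]. *)
Lemma is_weak_deriv_primitive (u w : R -> R) (c : R) :
  mu.-integrable `]0, 1[ (EFin \o w) ->
  (forall x, 0 < x < 1 -> u x = c + \int[mu]_(y in `]0, x[) w y) ->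
  is_weak_deriv u w.
Proof.
move=> iw uE.
pose W := w \_ `]0, 1[.
have iW : mu.-integrable setT (EFin \o W).
  by rewrite /W -restrict_EFin -integrable_mkcond.
have [V cV VE] := continuous_primitive ler01 iw.
have o01 : open (`]0, 1[%classic : set R) by apply: interval_open.
split.
- apply: open_integrable_locally => //.
  have : mu.-integrable `]0, 1[ (EFin \o (fun x => c + V x)).
    apply: (@integrableS _ _ _ mu `[0, 1]) => //; first exact: subset_itv_oo_cc.
    apply: continuous_compact_integrable; first exact: segment_compact.
    by move=> x; apply: cvgD; [exact: cvg_cst|exact: cV].
  by apply: eq_integrable => // x; rewrite inE/= in_itv/= => x01; rewrite uE// -VE.
- exact: open_integrable_locally.
move=> phi tphi.
have [dphi cphi' [a [b [a0 b1 phi0]]]] := tphi.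
have phi0' x : x \notin `]0, 1[ -> phi x = 0.
  move=> x01; apply: phi0; apply: contra x01; rewrite !in_itv/= => /andP[ax xb].
  by rewrite (lt_le_trans a0)//= (le_lt_trans xb).
have FTC y : 0 <= y < 1 -> \int[mu]_(x in `]y, 1[) derive1 phi x = - phi y.
  move=> /andP[y0 y1].
  have iphi' : mu.-integrable `[y, 1] (EFin \o derive1 phi).
    apply: continuous_compact_integrable; first exact: segment_compact.
    exact: continuous_subspaceT.
  have -> : - phi y = phi 1 - phi y by rewrite (phi0' 1) ?in_itv/= ?ltxx ?andbF// sub0r.
  rewrite /Rintegral -[phi 1 - phi y]/(fine ((phi 1)%:E - (phi y)%:E)) -(@continuous_FTC2 R (derive1 phi) phi y 1 y1).
  - congr fine; rewrite integral_itv_bndo_bndc ?integral_itv_obnd_cbnd//.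
      apply: measurable_funS (measurable_int mu iphi') => //.
      exact: subset_itv_oc_cc.
    apply: measurable_funS (measurable_int mu iphi') => //.
    exact: subset_itv_oo_cc.
  - exact: continuous_subspaceT.
  - split; first by move=> x _; exact: dphi.
    + by apply: cvg_at_right_filter; exact: test_fun_continuous.
    + by apply: cvg_at_left_filter; exact: test_fun_continuous.
  - by [].
(* Both factors are extended by zero so as to integrate over the plane. *)
pose F := derive1 phi \_ `]0, 1[.
have iphi' : mu.-integrable `[0, 1] (EFin \o derive1 phi).
  apply: continuous_compact_integrable; first exact: segment_compact.
  exact: continuous_subspaceT.
have iphi'o : mu.-integrable `]0, 1[ (EFin \o derive1 phi).
  by apply: integrableS iphi' => //; exact: subset_itv_oo_cc.
have iF : mu.-integrable setT (EFin \o F).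
  by rewrite /F -restrict_EFin -integrable_mkcond.
have := Fubini (integrable_prod_lt iF iW).
have -> : (\int[mu]_x \int[mu]_y (F x * (W y * (y < x)%R%:R))%:E =
    \int[mu]_(x in `]0%R, 1%R[) (V x * derive1 phi x)%:E)%E.
  rewrite [RHS]integral_mkcond; apply: eq_integral => x _.
  rewrite patchE mem_setE in_itv/= {1}/F.
  have [x01|x01] := boolP (0 < x < 1); last first.
    by rewrite patchE mem_setE in_itv/= (negbTE x01); under eq_integral do rewrite mul0r; rewrite integral0.
  rewrite VE// mulrC -integralZ_patch//; last first.
    apply: integrableS iw => // y /=; rewrite !in_itv/= => /andP[-> yx].
    by case/andP: x01 => _; exact: lt_trans.
  apply: eq_integral => y _; congr (_ * _)%:E; first by rewrite patchE mem_setE in_itv/= x01.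
  rewrite /W !patchE !mem_setE !in_itv/=.
  case/andP: x01 => x0 x1.
  case: (ltP y x) => yx; rewrite ?mulr0 ?andbF// mulr1 andbT.
  by rewrite (lt_trans yx x1) andbT.
have -> : (\int[mu]_y \int[mu]_x (F x * (W y * (y < x)%R%:R))%:E =
    \int[mu]_(y in `]0%R, 1%R[) (- (w y * phi y))%:E)%E.
  rewrite [RHS]integral_mkcond; apply: eq_integral => y _.
  rewrite patchE mem_setE in_itv/= {1}/W.
  have [y01|y01] := boolP (0 < y < 1); last first.
    by rewrite patchE mem_setE in_itv/= (negbTE y01); under eq_integral do rewrite mul0r mulr0; rewrite integral0.
  have /andP[y0 y1] := y01.
  rewrite -mulrN -FTC ?y1 ?ltW// -integralZ_patch//; last first.
    apply: integrableS iphi'o => // x /=; rewrite !in_itv/= => /andP[yx ->].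
    by rewrite (lt_trans y0 yx).
  apply: eq_integral => x _; rewrite /W patchE mem_setE in_itv/= y01 mulrCA.
  congr (_ * _)%:E; rewrite /F !patchE !mem_setE !in_itv/=.
  case: (ltP y x) => yx; rewrite ?mulr0// mulr1.
  by rewrite (lt_trans y0 yx).
move=> VwE.
have iVphi' : mu.-integrable `]0, 1[ (EFin \o (fun x => V x * derive1 phi x)).
  apply: (@integrableS _ _ _ mu `[0, 1]) => //; first exact: subset_itv_oo_cc.
  apply: continuous_compact_integrable; first exact: segment_compact.
  by move=> x; apply: cvgM; [exact: cV|exact: continuous_subspaceT].
have -> : \int[mu]_(x in `]0, 1[) (u x * derive1 phi x) =
    \int[mu]_(x in `]0, 1[) (c * derive1 phi x + V x * derive1 phi x).
  apply: eq_Rintegral => x; rewrite inE/= in_itv/= => x01.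
  by rewrite -mulrDl uE// VE.
rewrite RintegralD//; last first.
  have -> : EFin \o (fun x => c * derive1 phi x) = (fun x => c%:E * (derive1 phi x)%:E)%E.
    by apply/funext => x; rewrite -EFinM.
  exact: integrableZl.
rewrite RintegralZl// FTC ?lexx ?ltr01// phi0' ?in_itv/= ?ltxx//.
rewrite oppr0 mulr0 add0r {1}/Rintegral [X in fine X = _]VwE.
under eq_integral do rewrite EFinN.
rewrite integralN ?fineN//.
apply: integrable_add_def => //.
apply: integrable_mul_test_fun tphi => //.
exact: open_integrable_locally.
Qed.

End Primitive.

(** * Integrals of locally L^p functions *)

Section Integrals.
Context {R : realType}.
Notation mu := (@lebesgue_measure R).

Lemma lebesgue_measure_setT_gt0 : (0 < mu setT)%E.
Proof. by rewrite -set_itvNyy lebesgue_measure_itv/= addye// lt0y. Qed.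

(** On a bounded interval L^p is contained in L^1: [|h| <= 1 + |h| ^ r] for
    [r >= 1], and an essentially bounded function is integrable. *)
Lemma Lp_integrable (p : \bar R) (a b : R) (h : R -> R) : (1 <= p)%E ->
  Lp p `]a, b[ h -> mu.-integrable `]a, b[ (EFin \o h).
Proof.
move=> p1 lh; have mh : measurable_fun `]a, b[ h.
  have := sub_Lfun_mfun lh; rewrite inE/=.
  by move=> mhD; apply/(measurable_restrictT _ _).2.
have fin_ab : (mu `]a, b[ < +oo)%E.
  by rewrite lebesgue_measure_itv/=; case: ifP => // _; rewrite -EFinB ltry.
case: p p1 lh => [r|_|//].
  rewrite lee_fin => r1 lh.
  have ih := Lfun_integrable r1 lh.
  have ig : mu.-integrable `]a, b[ (fun x => 1%:E + (`|(h \_ `]a, b[) x| `^ r)%:E)%E.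
    apply: integrableD => //.
      apply: (@measurable_bounded_integrable _ _ _ mu (cst 1)) => //.
      by exists 1; split; [exact: num_real|move=> N N1 x _ /=; rewrite normr1 ltW].
    exact: integrableS ih.
  apply: le_integrable ig => //; first exact/measurable_EFinP.
  move=> x Dx /=; rewrite lee_fin patchE mem_set//.
  rewrite [X in _ <= X]ger0_norm ?addr_ge0 ?powR_ge0//.
  have [h1|h1] := leP `|h x| 1;
  first by apply: (le_trans h1); rewrite lerDl powR_ge0.
  apply: (@le_trans _ _ (`|h x| `^ r)); last by rewrite lerDr.
  by rewrite -[X in X <= _]powRr1 ?ler_powR// ltW.
move=> lh; have := sub_Lfun_finLfun lh; rewrite inE/= /finite_norm unlock.
rewrite /= lebesgue_measure_setT_gt0 => /ess_supr_bounded[M hM].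
apply/integrableP; split; first exact/measurable_EFinP.
apply: (@le_lt_trans _ _ (`|M|%:E * mu `]a, b[)%E).
  apply: integral_le_bound => //; first exact/measurable_EFinP.
  apply: filterS hM => x hM Dx; rewrite /= lee_fin.
  by move: hM; rewrite /= patchE mem_set// => /le_trans; apply; exact: ler_norm.
by rewrite lte_mul_pinfty.
Qed.

Lemma ae_exists_itv (a b : R) (P : R -> Prop) : a < b ->
  {ae mu, forall x, P x} -> exists2 x, a < x < b & P x.
Proof.
move=> ab [N [mN N0 PN]]; apply: contrapT => noP.
have : (mu `]a, b[ <= mu N)%E.
  apply: le_measure; rewrite ?inE//= => x /=; rewrite in_itv/= => xab.
  by apply: PN => /= Px; apply: noP; exists x.
by rewrite lebesgue_measure_itv/= lte_fin ab N0 -EFinB lee_fin leNgt subr_gt0 ab.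
Qed.

Lemma Rintegral_oo_split (x y z : R) (h : R -> R) : x <= y -> y <= z ->
  mu.-integrable `]x, z[ (EFin \o h) ->
  \int[mu]_(s in `]x, z[) h s = \int[mu]_(s in `]x, y[) h s + \int[mu]_(s in `]y, z[) h s.
Proof.
move=> xy; rewrite le_eqVlt => /predU1P[->|yz] ih.
  by rewrite [in X in _ = _ + X]set_itv_ge ?bnd_simp// Rintegral_set0 addr0.
have ixy : mu.-integrable `]x, y[ (EFin \o h).
  by apply: integrableS ih => //; apply: subset_itvl; rewrite bnd_simp ltW.
have <- : \int[mu]_(s in `]x, z[) h s - \int[mu]_(s in `]x, y]) h s =
    \int[mu]_(s in `]y, z[) h s.
  by apply: Rintegral_itvB; rewrite ?bnd_simp.
by rewrite (Rintegral_itv_bndo_bndc ixy) addrC subrK.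
Qed.

Lemma primitive0B (h : R -> R) (r s : R) : r <= s ->
  mu.-integrable `]Num.min 0 r, Num.max 0 s[ (EFin \o h) ->
  primitive0 h s - primitive0 h r = \int[mu]_(x in `]r, s[) h x.
Proof.
move=> rs ih.
have mh x y : Num.min 0 r <= x -> y <= Num.max 0 s -> measurable_fun `]x, y[ h.
  move=> rx ys; apply/measurable_EFinP; apply: measurable_funS (measurable_int mu ih) => //.
  move=> u /=; rewrite !in_itv/= => /andP[xu uy].
  by rewrite (le_lt_trans rx)//= (lt_le_trans uy).
have cc x y : Num.min 0 r <= x -> y <= Num.max 0 s ->
    \int[mu]_(u in `[x, y]) h u = \int[mu]_(u in `]x, y[) h u.
  move=> rx ys; congr fine; apply: integral_itv_bndoo.
  by apply/measurable_EFinP; exact: mh.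
rewrite /primitive0; have [s0|s0] := leP 0 s; have [r0|r0] := leP 0 r.
- rewrite !cc ?ge_min ?le_max ?lexx ?rs ?orbT//.
  rewrite (@Rintegral_oo_split 0 r s)//; first by rewrite addrC addKr.
  by move: ih; rewrite min_l// max_r.
- rewrite !cc ?ge_min ?le_max ?lexx ?rs ?orbT// opprK addrC -Rintegral_oo_split// ?(ltW r0)//.
  by move: ih; rewrite min_r ?(ltW r0)// max_r.
- by have := le_lt_trans (le_trans r0 rs) s0; rewrite ltxx.
- rewrite !cc ?ge_min ?le_max ?lexx ?rs ?orbT// opprK.
  rewrite (@Rintegral_oo_split r s 0) ?(ltW s0)//; first by rewrite addrC addrK.
  by move: ih; rewrite min_r ?(ltW r0)// max_l ?(ltW s0).
Qed.

End Integrals.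

(** * Solutions along characteristics *)

Section Characteristics.
Context {R : realType}.
Notation mu := (@lebesgue_measure R).

Lemma preimage_shift_itv (c a b : R) :
  (fun y => c + y) @^-1` `]c + a, c + b[ = `]a, b[%classic.
Proof. by apply/seteqP; split => y /=; rewrite !in_itv/= !ltrD2l. Qed.

Lemma preimage_refl_itv (c a b : R) :
  (fun y => c - y) @^-1` `]c - b, c - a[ = `]a, b[%classic.
Proof.
by apply/seteqP; split => y /=; rewrite !in_itv/= !ltrD2l !ltrN2 andbC.
Qed.

Lemma Lploc_integrable (p : \bar R) (a : R) (h : R -> R) (b c : R) :
  (1 <= p)%E -> Lploc p a h -> a <= b -> a < c ->
  mu.-integrable `]b, c[ (EFin \o h).
Proof.
move=> p1 [_ lh] ab ac; have := Lp_integrable p1 (lh c ac).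
by apply: integrableS => //; apply: subset_itvr; rewrite bnd_simp.
Qed.

Lemma integrable_shift (c a b : R) (h : R -> R) :
  mu.-integrable `]c + a, c + b[ (EFin \o h) ->
  mu.-integrable `]a, b[ (EFin \o (fun y => h (c + y))).
Proof.
move=> ih; rewrite -(preimage_shift_itv c).
exact: (lebesgue_preserving_integrable (lebesgue_preserving_shift c)).
Qed.

Lemma integrable_refl (c a b : R) (h : R -> R) :
  mu.-integrable `]c - b, c - a[ (EFin \o h) ->
  mu.-integrable `]a, b[ (EFin \o (fun y => h (c - y))).
Proof.
move=> ih; rewrite -(preimage_refl_itv c).
exact: (lebesgue_preserving_integrable (lebesgue_preserving_refl c)).
Qed.

Lemma primitive0_shift (p : \bar R) (f : R -> R) (t x : R) : (1 <= p)%E ->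
  Lploc p 0 f -> 0 <= t -> 0 < x ->
  primitive0 f (t + x) = primitive0 f t + \int[mu]_(y in `]0, x[) f (t + y).
Proof.
move=> p1 lf t0 x0.
have ttx : t <= t + x by rewrite lerDl ltW.
have tx0 : 0 < t + x by rewrite ltr_wpDl.
have ih := Lploc_integrable p1 lf (lexx 0) tx0.
have := primitive0B ttx; rewrite min_l// max_r ?(ltW tx0)// => /(_ f ih).
have -> : \int[mu]_(y in `]t, t + x[) f y = \int[mu]_(y in `]0, x[) f (t + y).
  rewrite -[in RHS](preimage_shift_itv t) addr0.
  rewrite (lebesgue_preserving_Rintegral (lebesgue_preserving_shift t))//.
  by apply: integrableS ih => //; apply: subset_itvr; rewrite bnd_simp.
by move=> <-; rewrite [RHS]addrC subrK.
Qed.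

Lemma primitive0_refl (p : \bar R) (g : R -> R) (t x : R) : (1 <= p)%E ->
  Lploc p (-1) g -> 0 <= t -> 0 < x -> x < 1 ->
  primitive0 g (t - x) = primitive0 g t - \int[mu]_(y in `]0, x[) g (t - y).
Proof.
move=> p1 lg t0 x0 x1.
have ttx : t - x <= t by rewrite gerBl ltW.
have tm1 : -1 <= Num.min 0 (t - x) by rewrite le_min; apply/andP; split; lra.
have tp1 : -1 < Num.max 0 t by rewrite lt_max ltrN10.
have ih := Lploc_integrable p1 lg tm1 tp1.
have := primitive0B ttx ih.
have -> : \int[mu]_(y in `]t - x, t[) g y = \int[mu]_(y in `]0, x[) g (t - y).
  rewrite -[in RHS](preimage_refl_itv t) subr0.
  rewrite (lebesgue_preserving_Rintegral (lebesgue_preserving_refl t))//.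
  apply: integrableS ih => // y /=; rewrite !in_itv/= => /andP[xy yt].
  by rewrite gt_min lt_max xy yt !orbT.
by move=> <-; rewrite opprB [RHS]addrC subrK.
Qed.

(** Changing variables in the two primitives writes [z t] as a constant plus the
    primitive from [0] of [wave_x f g t]. *)
Lemma wave_weak_deriv (p : \bar R) (z : R -> R -> R) (f g : R -> R) (t : R) :
  (1 <= p)%E -> Lploc p 0 f -> Lploc p (-1) g ->
  (forall t x, 0 <= t -> 0 <= x <= 1 ->
    z t x = (Num.sqrt 2)^-1 * primitive0 f (t + x) +
            (Num.sqrt 2)^-1 * primitive0 g (t - x)) ->
  0 <= t -> is_weak_deriv (z t) (wave_x f g t).
Proof.
move=> p1 lf lg zE t0.
have i_f : mu.-integrable `]0, 1[ (EFin \o (fun y => f (t + y))).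
  apply: integrable_shift; apply: Lploc_integrable p1 lf _ _; lra.
have i_g : mu.-integrable `]0, 1[ (EFin \o (fun y => g (t - y))).
  apply: integrable_refl; apply: Lploc_integrable p1 lg _ _; lra.
have ifg : mu.-integrable `]0, 1[ (EFin \o (fun y => f (t + y) - g (t - y))).
  exact: (integrableB _ i_f i_g).
apply: (@is_weak_deriv_primitive _ _ _
    ((Num.sqrt 2)^-1 * (primitive0 f t + primitive0 g t))).
  have -> : EFin \o wave_x f g t =
    (fun y => (Num.sqrt 2)^-1%:E * (f (t + y)%R - g (t - y)%R)%R%:E)%E.
    by apply/funext => y; rewrite -EFinM /= /wave_x mulrC.
  exact: integrableZl.
move=> x /andP[x0 x1]; rewrite zE ?(ltW x0) ?(ltW x1)//.
rewrite (primitive0_shift p1 lf)// (primitive0_refl p1 lg)//.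
have S01 : `]0, x[ `<=` (`]0, 1[%classic : set R).
  by apply: subset_itvl; rewrite bnd_simp ltW.
have -> : \int[mu]_(y in `]0, x[) wave_x f g t y =
    (Num.sqrt 2)^-1 * (\int[mu]_(y in `]0, x[) f (t + y) -
      \int[mu]_(y in `]0, x[) g (t - y)).
  rewrite -RintegralB//;
    [|exact: integrableS i_f|exact: integrableS i_g].
  rewrite -RintegralZl//; last exact: integrableS ifg.
  by apply: eq_Rintegral => y _; rewrite mulrC.
by rewrite -!mulrDr; congr (_ * _); rewrite addrACA.
Qed.

End Characteristics.

Section BoundaryConditions.
Context {R : realType}.
Notation mu := (@lebesgue_measure R).

(** A primitive is continuous, so that if it vanishes almost everywhere, it
    vanishes everywhere. *)
Lemma ae_eq0_of_ae_primitive_eq0 (T : R) (h : R -> R) :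
  mu.-integrable `]0, T[ (EFin \o h) ->
  {ae mu, forall t, 0 < t < T -> \int[mu]_(y in `]0, t[) h y = 0} ->
  {ae mu, forall t, 0 < t < T -> h t = 0}.
Proof.
move=> ih h0; have [T0|T0] := ltP 0 T; last first.
  apply: aeW => t /andP[t0 tT].
  by have := lt_le_trans (lt_trans t0 tT) T0; rewrite ltxx.
apply: ae_eq0_of_primitive_eq0 => // x x0T.
have [V cV VE] := continuous_primitive (ltW T0) ih.
rewrite -Rintegral_itv_bndo_bndc; last first.
  apply: integrableS ih => //; apply: subset_itvl; rewrite bnd_simp.
  by case/andP: x0T => _ /ltW.
rewrite -VE//; apply/eqP; apply: contrapT => /negP Vx0.
have [/(_ x _)/= cVx _ _] := (continuous_within_itvP _ T0).1 cV.
have xin : x \in `]0, T[ by rewrite in_itv.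
have : \forall y \near x, V y != 0 /\ (y \in `]0, T[).
  near=> y; split; last by near: y; exact: near_in_itvoo.
  by near: y; exact: (cvgr_neq0 (V x) (cVx xin) Vx0).
move=> /nbhs_ballP[e /= e0 xe].
have [|y /andP[xy yx] hy] := @ae_exists_itv _ (x - e) (x + e) _ _ h0; first lra.
have [|] := xe y; first by rewrite /ball/= ltr_norml; lra.
rewrite in_itv/= => Vy y0T; move: Vy; rewrite VE// hy//.
by rewrite eqxx.
Unshelve. all: by end_near. Qed.

Lemma dirichlet_reflection (p : \bar R) (z : R -> R -> R) (f g : R -> R) :
  (1 <= p)%E -> Lploc p 0 f -> Lploc p (-1) g ->
  (forall t x, 0 <= t -> 0 <= x <= 1 ->
    z t x = (Num.sqrt 2)^-1 * primitive0 f (t + x) +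
            (Num.sqrt 2)^-1 * primitive0 g (t - x)) ->
  {ae mu, forall t, 0 <= t -> z t 0 = 0} ->
  {ae mu, forall t, 0 < t -> f t = - g t}.
Proof.
move=> p1 lf lg zE z0.
have aen (n : nat) : {ae mu, forall t, 0 < t < n.+1%:R -> (f \+ g) t = 0}.
  have n0 : 0 < n.+1%:R :> R by [].
  have i_f := Lploc_integrable p1 lf (lexx 0) n0.
  have i_g : mu.-integrable `]0, n.+1%:R[ (EFin \o g).
    by apply: Lploc_integrable p1 lg _ _ => //; rewrite (lt_trans _ n0).
  apply: ae_eq0_of_ae_primitive_eq0; first exact: (integrableD _ i_f i_g).
  apply: (ae_imp z0) => t zt /andP[t0 tn].
  have := zt (ltW t0); rewrite zE ?lexx ?ler01 ?(ltW t0)// addr0 subr0 -mulrDr => /eqP.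
  rewrite mulf_eq0 invr_eq0 sqrtr_eq0 leNgt ltr0n/= => /eqP fg0.
  have S : `]0, t[%classic `<=` (`]0, n.+1%:R[%classic : set R).
    by apply: subset_itvl; rewrite bnd_simp ltW.
  have i_f' : mu.-integrable `]0, t[ (EFin \o f) by exact: integrableS i_f.
  have i_g' : mu.-integrable `]0, t[ (EFin \o g) by exact: integrableS i_g.
  rewrite RintegralD// -[RHS]fg0 /primitive0 (ltW t0); congr (_ + _); congr fine.
    by rewrite (@integral_itv_bndoo _ 0 t _ true false)//; exact: (measurable_int mu i_f').
  by rewrite (@integral_itv_bndoo _ 0 t _ true false)//; exact: (measurable_int mu i_g').
apply: (ae_imp (ae_foralln aen)) => t fg t0.
apply/eqP; rewrite -addr_eq0; apply/eqP; apply: (fg (Num.truncn t)).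
by rewrite t0 truncnS_gt.
Qed.

(** The rotation passes to the Riemann invariants: its components are the
    right-moving wave and, up to sign, the left-moving one. *)
Lemma rotation_wave (f g : R -> R) (t x : R) :
  rotation (wave_t f g t x, - wave_x f g t x) = (g (t - x), - f (t + x)).
Proof.
have s0 : Num.sqrt 2 != 0 :> R by rewrite gt_eqF// sqrtr_gt0.
have s2 : Num.sqrt 2 * Num.sqrt 2 = 2 :> R by rewrite -expr2 sqr_sqrtr.
rewrite /rotation /wave_t /wave_x /=; congr (_, _).
  by rewrite -mulrBl -mulrA -invfM s2; field.
by rewrite -opprD -mulrDl mulNr -mulrA -invfM s2; field.
Qed.

(** A null set of times is avoided simultaneously by all the times [s + 1 + 2i],
    because there are countably many translations, each preserving null sets. *)
Lemma wave_recursion (Sigma : set (R * R)) (S : R -> set R) (p : \bar R)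
    (z0 z1 : R -> R) (z : R -> R -> R) (f g : R -> R) :
  svmap_graph S = rotation @` Sigma -> (1 <= p)%E ->
  wave_solution_by Sigma p z0 z1 z f g ->
  {ae mu, forall s, -1 < s -> forall i, S (g (i.*2%:R + s)) (g (i.+1.*2%:R + s))}.
Proof.
move=> SE p1 [[lf lg] zE bc _].
have fgE : {ae mu, forall t, 0 < t -> f t = - g t}.
  apply: (dirichlet_reflection p1 lf lg zE).
  by apply: (ae_imp bc) => t bct t0; have [] := bct t0.
have key : {ae mu, forall t, 0 <= t -> S (g (t - 1)) (g (t + 1))}.
  have fgE' := lebesgue_preserving_ae (lebesgue_preserving_shift 1) fgE.
  apply: (ae_imp2 bc fgE') => t bct fgt t0.
  have [_ St] := bct t0.
  have : svmap_graph S (g (t - 1), - f (t + 1)).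
    by rewrite SE -(rotation_wave f g t 1); exists (wave_t f g t 1, - wave_x f g t 1).
  by rewrite /svmap_graph/= [t + 1]addrC fgt ?opprK//; lra.
have aei i := lebesgue_preserving_ae (lebesgue_preserving_shift (i.*2%:R + 1)) key.
apply: (ae_imp (ae_foralln aei)) => s Ss s1 i.
have := Ss i; have -> : i.*2%:R + 1 + s - 1 = i.*2%:R + s by ring.
have -> : i.*2%:R + 1 + s + 1 = i.+1.*2%:R + s.
  by rewrite doubleS -addn2 natrD; ring.
by apply; have : 0 <= i.*2%:R :> R by []; lra.
Qed.

End BoundaryConditions.

(** * The energy as a norm on a sliding window *)

Section Energy.
Context {R : realType}.
Notation mu := (@lebesgue_measure R).

Lemma ge0_integral_oo_split (x y z : R) (h : R -> \bar R) : x < y -> y < z ->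
  measurable_fun `]x, z[ h -> (forall s, 0 <= h s)%E ->
  (\int[mu]_(s in `]x, z[) h s =
   \int[mu]_(s in `]x, y[) h s + \int[mu]_(s in `]y, z[) h s)%E.
Proof.
move=> xy yz mh h0.
have mxy : measurable_fun `]x, y[ h.
  by apply: measurable_funS mh => //; apply: subset_itvl; rewrite bnd_simp ltW.
rewrite (@itv_bndbnd_setU _ _ (BRight x) (BRight y)) ?bnd_simp//; last exact: ltW.
rewrite ge0_integral_setU//.
- by rewrite -integral_itv_bndo_bndc.
- by rewrite -itv_bndbnd_setU ?bnd_simp//; exact: ltW.
- apply/disj_setPS => s [/=]; rewrite !in_itv/= => /andP[_ sy] /andP[ys _].
  by have := le_lt_trans sy ys; rewrite ltxx.
Qed.

(** The condition [0 <= M] matters when [D] is null. *)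
Lemma Lnorm_pinfty_le (D : set R) (h : R -> R) (M : R) :
  ('N[mu]_+oo[EFin \o (h \_ D)] <= M%:E)%E <->
  0 <= M /\ {ae mu, forall x, D x -> `|h x| <= M}.
Proof.
rewrite unlock /= lebesgue_measure_setT_gt0; split.
  move=> hM; split.
    rewrite -lee_fin; apply: le_trans hM; apply: ess_sup_gee.
      exact: lebesgue_measure_setT_gt0.
    by apply: aeW => x /=; rewrite lee_fin.
  move/ess_supP : hM => hM; apply: (ae_imp hM) => x /= hx Dx.
  by move: hx; rewrite lee_fin patchE mem_set.
move=> [M0 hM]; apply/ess_supP; apply: (ae_imp hM) => x /= hx.
rewrite lee_fin patchE; case: ifPn => [|_]; last by rewrite normr0.
by rewrite inE => /hx.
Qed.

Lemma measurable_norm_powR (D : set R) (h : R -> R) (r : R) :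
  measurable_fun D h -> measurable_fun D (fun x => `|h x| `^ r).
Proof.
move=> mh.
apply: (@measurableT_comp _ _ _ _ _ _ (@powR R ^~ r)); first exact: measurable_powR.
exact: measurableT_comp.
Qed.

Context (p : \bar R) (z : R -> R -> R) (f g : R -> R) (t : R).
Context (p1 : (1 <= p)%E) (lf : Lploc p 0 f) (lg : Lploc p (-1) g).
Context (zE : forall t x, 0 <= t -> 0 <= x <= 1 ->
  z t x = (Num.sqrt 2)^-1 * primitive0 f (t + x) +
          (Num.sqrt 2)^-1 * primitive0 g (t - x)).
Context (fgE : {ae mu, forall t, 0 < t -> f t = - g t}) (t0 : 0 <= t).

Let sqrt2 : 0 < Num.sqrt 2 :> R. Proof. by rewrite sqrtr_gt0. Qed.

(** Since [f = - g] after time 0, both Riemann invariants are values of [g], taken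
    on the two halves of the window around [t]. *)
Lemma energy_ae : {ae mu, forall x, 0 < x < 1 ->
  weak_deriv (z t) x + wave_t f g t x = - (Num.sqrt 2 * g (t + x)) /\
  weak_deriv (z t) x - wave_t f g t x = - (Num.sqrt 2 * g (t - x))}.
Proof.
have [_ du] := weak_deriv_ae (wave_weak_deriv p1 lf lg zE t0).
have fg := lebesgue_preserving_ae (lebesgue_preserving_shift t) fgE.
apply: (ae_imp2 du fg) => x dux fgx x01.
have s2 : Num.sqrt 2 * Num.sqrt 2 = 2 :> R by rewrite -expr2 sqr_sqrtr.
have s0 : Num.sqrt 2 != 0 :> R by rewrite gt_eqF.
rewrite dux// /wave_x /wave_t fgx; last by case/andP: x01 => x0 _; exact: ltr_wpDl.
have -> : (Num.sqrt 2)^-1 = Num.sqrt 2 / 2 :> R.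
  by apply: (mulIf s0); rewrite mulVf// mulrAC s2 divff.
by split; field.
Qed.

Let measurable_wave (a b : R) : -1 <= a -> measurable_fun `]a, b[ g.
Proof.
move=> a1; have [mg _] := lg; apply: measurable_funS mg => //.
by move=> x /=; rewrite !in_itv/= andbT => /andP[ax _]; exact: le_lt_trans ax.
Qed.

(** For [p = +oo] the energy is characterized by its upper bounds: the maximum of
    two essential suprema is thus merged into a condition on one window. *)
Lemma energy_pinfty_le (M : R) : (energy +oo z f g t <= M%:E)%E <->
  0 <= M /\ {ae mu, forall x, t - 1 < x < t + 1 -> `|g x| <= M}.
Proof.
rewrite /energy /Xp_norm lee_pdivrMl// -EFinM ge_max.
have sM (y : R) : (`|- (Num.sqrt 2 * y)| <= Num.sqrt 2 * M) = (`|y| <= M).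
  by rewrite normrN normrM (ger0_norm (ltW sqrt2)) ler_pM2l.
split.
  move=> /andP[/Lnorm_pinfty_le[M0 hp] /Lnorm_pinfty_le[_ hm]].
  split; first by rewrite pmulr_rge0 in M0.
  have hp' : {ae mu, forall x, 0 < x < 1 -> `|g (t + x)| <= M}.
    apply: (ae_imp2 energy_ae hp) => x ex hx x01.
    by rewrite -sM -(ex x01).1; apply: hx; rewrite /= in_itv.
  have hm' : {ae mu, forall x, 0 < x < 1 -> `|g (t - x)| <= M}.
    apply: (ae_imp2 energy_ae hm) => x ex hx x01.
    by rewrite -sM -(ex x01).2; apply: hx; rewrite /= in_itv.
  have hr := lebesgue_preserving_ae (lebesgue_preserving_shift (- t)) hp'.
  have hl := lebesgue_preserving_ae (lebesgue_preserving_refl t) hm'.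
  apply: (ae_imp2 (ae_imp2 hr hl (fun x => @conj _ _)) (ae_neq t)) => x [hx hx'] xt /andP[x1 x2].
  have [tx|xt'] := ltP t x.
    by have := hx; rewrite addrA subrr add0r; apply; lra.
  have := hx'; rewrite opprB addrCA subrr addr0; apply.
  by rewrite subr_gt0 lt_neqAle xt xt' /=; lra.
move=> [M0 hM].
have hM1 := lebesgue_preserving_ae (lebesgue_preserving_shift t) hM.
have hM2 := lebesgue_preserving_ae (lebesgue_preserving_refl t) hM.
apply/andP; split; apply/Lnorm_pinfty_le; (split; first by rewrite mulr_ge0// ltW).
  apply: (ae_imp2 energy_ae hM1) => x ex hx /=; rewrite in_itv/= => x01.
  by rewrite (ex x01).1 sM; apply: hx; lra.
apply: (ae_imp2 energy_ae hM2) => x ex hx /=; rewrite in_itv/= => x01.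
by rewrite (ex x01).2 sM; apply: hx; lra.
Qed.

Lemma energy_finE (r : R) : 1 <= r ->
  energy r%:E z f g t =
    ((\int[mu]_(x in `](t - 1)%R, (t + 1)%R[) (`|g x| `^ r)%:E) `^ r^-1)%E.
Proof.
move=> r1; rewrite /energy /Xp_norm; congr poweR.
have r0 : 0 < r by exact: lt_le_trans r1.
have t_ge0 := t0.
have [ldu _] := weak_deriv_ae (wave_weak_deriv p1 lf lg zE t0).
have [mdu _ _] := ldu.
have mshift (h : R -> R) : mu.-integrable `]t, t + 1[ (EFin \o h) ->
    measurable_fun (`]0%R, 1%R[ : set R) (fun x : R => h (t + x)).
  move=> ih; apply/measurable_EFinP; apply: (measurable_int mu).
  by apply: integrable_shift; rewrite addr0.
have mf : measurable_fun (`]0%R, 1%R[ : set R) (fun x : R => f (t + x)).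
  by apply: mshift; apply: Lploc_integrable p1 lf _ _ => //; lra.
have mgp : measurable_fun (`]0%R, 1%R[ : set R) (fun x : R => g (t + x)).
  by apply: mshift; apply: Lploc_integrable p1 lg _ _ => //; lra.
have mgm : measurable_fun (`]0%R, 1%R[ : set R) (fun x : R => g (t - x)).
  apply/measurable_EFinP; apply: (measurable_int mu); apply: integrable_refl.
  by apply: Lploc_integrable p1 lg _ _; lra.
have mv : measurable_fun (`]0%R, 1%R[ : set R) (wave_t f g t).
  by apply: measurable_funM => //; exact: measurable_funD.
have mA := (measurable_EFinP _ _).2 (measurable_norm_powR r mgp).
have mB := (measurable_EFinP _ _).2 (measurable_norm_powR r mgm).
have sqr2r : Num.sqrt 2 `^ r = 2 `^ (r / 2) :> R.
  by rewrite -powR12_sqrt// -powRrM mulrC.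
have powN2 (y : R) : `|- (Num.sqrt 2 * y)| `^ r = 2 `^ (r / 2) * `|y| `^ r.
  by rewrite normrN normrM powRM// ger0_norm ?(ltW sqrt2)// sqr2r.
transitivity ((2 `^ (- (r / 2)))%:E * \int[mu]_(x in `]0%R, 1%R[)
    ((2 `^ (r / 2))%:E * ((`|g (t + x)%R| `^ r)%:E + (`|g (t - x)%R| `^ r)%:E)))%E.
  congr (_ * _)%E; apply: ge0_ae_eq_integral => //.
  - apply/measurable_EFinP.
    apply: measurable_funD; apply: measurable_norm_powR.
      exact: measurable_funD.
    exact: measurable_funB.
  - by apply: emeasurable_funM => //; exact: emeasurable_funD.
  - by move=> x _; rewrite mule_ge0 ?adde_ge0 ?lee_fin ?powR_ge0.
  apply: (ae_imp energy_ae) => x ex; rewrite /= in_itv/= => x01.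
  by rewrite (ex x01).1 (ex x01).2 !powN2 -mulrDr.
rewrite ge0_integralZl_EFin//; 
  [|by move=> x _; rewrite adde_ge0 ?lee_fin ?powR_ge0|exact: emeasurable_funD].
rewrite muleA -EFinM powRN mulVf ?gt_eqF ?powR_gt0// mul1e.
rewrite ge0_integralD//.
have mg (a b : R) : -1 <= a -> measurable_fun `]a, b[ (fun x => (`|g x| `^ r)%:E).
  by move=> ?; apply/measurable_EFinP; apply: measurable_norm_powR; exact: measurable_wave.
have t1 : t - 1 < t by rewrite gtrBl.
have t2 : t < t + 1 by rewrite ltrDl.
have tm1 : -1 <= t - 1 by lra.
apply: etrans (esym (ge0_integral_oo_split t1 t2 (mg _ _ tm1) _)); last by [].
apply: etrans (addeC _ _) _; apply: (f_equal2 adde).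
  have := @lebesgue_preserving_ge0_integral _ _ `]t - 1, t[%classic
    (fun x => (`|g x| `^ r)%:E) (lebesgue_preserving_refl t).
  rewrite -[X in _ @^-1` `]_, X[%classic]subr0 preimage_refl_itv; apply => //.
  by apply: mg; lra.
have := @lebesgue_preserving_ge0_integral _ _ `]t, t + 1[%classic
  (fun x => (`|g x| `^ r)%:E) (lebesgue_preserving_shift t).
rewrite -[X in _ @^-1` `]X, _[%classic]addr0 preimage_shift_itv; apply => //.
by apply: mg; lra.
Qed.

End Energy.

(** * From contraction to exponential decay *)

Section Sufficiency.
Context {R : realType}.
Notation mu := (@lebesgue_measure R).

(** In rotated coordinates, [u * v >= 0] is [|v - u| <= |u + v|]. *)
Lemma damping_svmap_le (Sigma : set (R * R)) (S : R -> set R) (x y : R) :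
  (forall xy, Sigma xy -> 0 <= xy.1 * xy.2) ->
  svmap_graph S = rotation @` Sigma -> S x y -> `|y| <= `|x|.
Proof.
move=> dS SE Sxy; have : svmap_graph S (x, y) by [].
rewrite SE => -[[u v] /dS /= uv0 [<- <-]].
rewrite !normrM ler_wpM2r// -ler_sqr ?nnegrE// -!normrX !ger0_norm ?sqr_ge0//.
nra.
Qed.

(** Each block of [n] steps contracts by [m], and the remaining steps do not
    increase the absolute value. *)
Lemma orbit_contraction (S : R -> set R) (m : R) (n : nat) (a : nat -> R) :
  0 <= m -> (0 < n)%N -> (forall x y, S x y -> `|y| <= `|x|) ->
  (forall x, (set_norm (svmap_iter S n x) <= (m * `|x|)%:E)%E) ->
  (forall i, S (a i) (a i.+1)) ->
  forall k, `|a k| <= m ^+ (k %/ n) * `|a 0%N|.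
Proof.
move=> m0 n0 Sle Sn aS k.
have drop i j : `|a (i + j)%N| <= `|a i|.
  elim: j => [|j IH]; first by rewrite addn0.
  by rewrite addnS; apply: le_trans IH; exact: Sle.
rewrite {1}(divn_eq k n); apply: le_trans (drop _ _) _.
elim: (k %/ n)%N => [|q IH]; first by rewrite mul0n expr0 mul1r.
have : svmap_iter S n (a (q * n)%N) (a (q.+1 * n)%N).
  exists (fun i => a (q * n + i)%N); split; rewrite ?addn0//.
    by rewrite mulSn addnC.
  by move=> i _; rewrite addnS.
move=> it; have : (`|a (q.+1 * n)%N|%:E <= (m * `|a (q * n)%N|)%:E)%E.
  apply: le_trans (Sn _); apply: ereal_sup_ubound.
  by exists (a (q.+1 * n)%N).
rewrite lee_fin => /le_trans; apply.
by rewrite exprS -mulrA ler_wpM2l.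
Qed.

Lemma integral_shift_le (g : R -> R) (r T c : R) :
  measurable_fun (`]-1, +oo[ : set R) g -> 0 <= r -> 0 <= T -> 0 <= c ->
  {ae mu, forall s, -1 < s < 1 -> `|g (T + s)| <= c * `|g s|} ->
  (\int[mu]_(x in `](T - 1)%R, (T + 1)%R[) (`|g x| `^ r)%:E <=
   (c `^ r)%:E * \int[mu]_(x in `](-1)%R, 1%R[) (`|g x| `^ r)%:E)%E.
Proof.
move=> mg r0 T0 c0 gT.
have mgab (a b : R) : -1 <= a -> measurable_fun `]a, b[ g.
  move=> a1; apply: measurable_funS mg => // x /=.
  by rewrite !in_itv/= andbT => /andP[ax _]; exact: le_lt_trans ax.
have mE (a b : R) : -1 <= a -> measurable_fun `]a, b[ (fun x => (`|g x| `^ r)%:E).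
  by move=> ?; apply/measurable_EFinP; apply: measurable_norm_powR; exact: mgab.
have T1 : -1 <= T - 1 by lra.
have mgT : measurable_fun (`](-1)%R, 1%R[ : set R) (fun x : R => g (T + x)).
  apply: (@measurable_comp _ _ _ _ _ _ `]T - 1, T + 1[%classic) => //.
  - by move=> _ [x /= + <-]; rewrite !in_itv/= !ltrD2l.
  - exact: mgab.
  - by apply: measurable_funTS; exact: (lebesgue_preserving_shift T).1.
rewrite -(lebesgue_preserving_ge0_integral (lebesgue_preserving_shift T))//; last exact: mE.
rewrite preimage_shift_itv -ge0_integralZl_EFin ?powR_ge0//; last exact: mE.
apply: ae_ge0_le_integral => //.
- by apply/measurable_EFinP; exact: measurable_norm_powR.
- by move=> x _; rewrite -EFinM lee_fin mulr_ge0 ?powR_ge0.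
- by apply: emeasurable_funM => //; exact: mE.
apply: (ae_imp gT) => x gx; rewrite /= in_itv/= => x11.
rewrite -EFinM lee_fin -powRM//; apply: ge0_ler_powR; rewrite ?nnegrE ?mulr_ge0//.
exact: gx.
Qed.

Lemma Xp_norm_ge0 (p : \bar R) (uv : (R -> R) * (R -> R)) : (0 <= Xp_norm p uv)%E.
Proof.
rewrite /Xp_norm; case: p => [r||] //; first exact: poweR_ge0.
by rewrite mule_ge0 ?lee_fin ?invr_ge0 ?sqrtr_ge0// le_max Lnorm_ge0.
Qed.

(** The window of time [t] is contained in the union of the windows of times [T]
    and [T + 2], up to the common endpoint [T + 1]; each contributes at most
    [c] times the initial energy. *)
Lemma energy_decay (p : \bar R) (z : R -> R -> R) (f g : R -> R) (t T c : R) :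
  (1 <= p)%E -> Lploc p 0 f -> Lploc p (-1) g ->
  (forall t x, 0 <= t -> 0 <= x <= 1 ->
    z t x = (Num.sqrt 2)^-1 * primitive0 f (t + x) +
            (Num.sqrt 2)^-1 * primitive0 g (t - x)) ->
  {ae mu, forall t, 0 < t -> f t = - g t} ->
  0 <= T -> T <= t < T + 2 -> 0 < c ->
  {ae mu, forall s, -1 < s < 1 -> `|g (T + s)| <= c * `|g s|} ->
  {ae mu, forall s, -1 < s < 1 -> `|g (T + 2 + s)| <= c * `|g s|} ->
  (energy p z f g t <= (2 * c)%:E * energy p z f g 0)%E.
Proof.
move=> p1 lf lg zE fgE T0 /andP[Tt tT] c0 gT gT2.
have t0 : 0 <= t by exact: le_trans Tt.
have [mg _] := lg.
case: p p1 lf lg => [r||//] p1 lf lg.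
- have r1 : 1 <= r by [].
  have r0 : 0 < r by exact: lt_le_trans r1.
  rewrite (energy_finE p1 lf lg zE fgE t0 r1) (energy_finE p1 lf lg zE fgE (lexx 0) r1).
  rewrite !add0r; set I := (\int[mu]_(x in `](-1)%R, _[) _)%E.
  have I0 : (0 <= I)%E by apply: integral_ge0 => x _; rewrite lee_fin powR_ge0.
  have c20 : 0 <= 2 * c by lra.
  have cI0 : (0 <= ((2 * c) `^ r)%:E * I)%E by rewrite mule_ge0 ?lee_fin ?powR_ge0.
  apply: (@le_trans _ _ ((((2 * c) `^ r)%:E * I) `^ r^-1)%E); last first.
    rewrite poweRM// ?lee_fin ?powR_ge0// poweR_EFin -powRrM divff ?gt_eqF//.
    by rewrite powRr1.
  apply: gt0_ler_poweR; rewrite ?invr_ge0 ?(ltW r0)//.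
  + rewrite in_itv/= leey andbT; apply: integral_ge0 => x _.
    by rewrite lee_fin powR_ge0.
  + by rewrite in_itv/= leey andbT.
  have mE (a b : R) : -1 <= a -> measurable_fun `]a, b[ (fun x => (`|g x| `^ r)%:E).
    move=> a1; apply/measurable_EFinP; apply: measurable_norm_powR.
    apply: measurable_funS mg => // x /=.
    by rewrite !in_itv/= andbT => /andP[ax _]; exact: le_lt_trans ax.
  have T1 : T - 1 < T + 1 by lra.
  have T2 : T + 1 < T + 2 + 1 by lra.
  apply: (@le_trans _ _ (\int[mu]_(x in `](T - 1)%R, (T + 2 + 1)%R[) (`|g x| `^ r)%:E)%E).
    apply: ge0_subset_integral => //; first by apply: mE; lra.
    by move=> x /=; rewrite !in_itv/= => /andP[xt tx]; apply/andP; split; lra.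
  rewrite (ge0_integral_oo_split T1 T2)//; last by apply: mE; lra.
  have c0' := ltW c0.
  have e1 : T + 1 = T + 2 - 1 by ring.
  have leI := integral_shift_le mg (ltW r0) T0 c0' gT.
  have T20 : 0 <= T + 2 by lra.
  have := integral_shift_le mg (ltW r0) T20 c0' gT2; rewrite -e1 => leI2.
  apply: le_trans (leeD leI leI2) _; rewrite -/I.
  rewrite -ge0_muleDl ?lee_fin ?powR_ge0//; apply: lee_wpmul2r => //.
  rewrite -EFinD lee_fin powRM//.
  (* Since [1 <= r], the number of windows is absorbed in the factor [2]. *)
  have -> : c `^ r + c `^ r = 2 * c `^ r by ring.
  by rewrite ler_wpM2r ?powR_ge0// le1r_powR// ler1n.
have [E0|E0] : energy +oo z f g 0 = +oo%E \/ exists M, energy +oo z f g 0 = M%:E.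
  case E : (energy +oo z f g 0) => [M| |]; [by right; exists M|by left|].
  exfalso; have : (energy +oo z f g 0 <= (-1)%:E)%E by rewrite E leNye.
  by move=> /(energy_pinfty_le p1 lf lg zE fgE (lexx 0))[]; rewrite ler0N1.
  by rewrite E0 gt0_muley ?leey// lte_fin; lra.
case: E0 => M E0; rewrite E0 -EFinM.
have : (energy +oo z f g 0 <= M%:E)%E by rewrite E0.
move=> /(energy_pinfty_le p1 lf lg zE fgE (lexx 0))[M0 gM].
apply/(energy_pinfty_le p1 lf lg zE fgE t0).
have cM : 0 <= c * M by rewrite mulr_ge0// ltW.
split; first by rewrite -mulrA mulr_ge0.
have bnd U : {ae mu, forall s, -1 < s < 1 -> `|g (U + s)| <= c * `|g s|} ->
    {ae mu, forall x, U - 1 < x < U + 1 -> `|g x| <= 2 * c * M}.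
  move=> gU.
  have aes : {ae mu, forall s, -1 < s < 1 -> `|g (U + s)| <= 2 * c * M}.
    apply: (ae_imp2 gU gM) => s gUs gs s1.
    apply: (le_trans (gUs s1)); apply: (@le_trans _ _ (c * M)); last lra.
    by rewrite ler_pM2l//; apply: gs; rewrite sub0r add0r.
  apply: (ae_imp (lebesgue_preserving_ae (lebesgue_preserving_shift (- U)) aes)).
  move=> x hx xU; have := hx; rewrite addrA subrr add0r; apply; lra.
apply: (ae_imp2 (ae_imp2 (bnd _ gT) (bnd _ gT2) (fun x => @conj _ _)) (ae_neq (T + 1))).
move=> x [hx1 hx2] xT /andP[x1 x2].
case: (ltgtP x (T + 1)) xT => // xT _; [apply: hx1|apply: hx2]; lra.
Qed.

Theorem GES_of_contraction (Sigma : set (R * R)) (p : \bar R) (S : R -> set R)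
    (m : R) (n : nat) : damping_set Sigma -> (1 <= p)%E ->
  svmap_graph S = rotation @` Sigma -> 0 < m < 1 -> (0 < n)%N ->
  (forall x, (set_norm (svmap_iter S n x) <= (m * `|x|)%:E)%E) ->
  GES Sigma p.
Proof.
move=> [_ dS _] p1 SE /andP[m0 m1] n0 Sn.
have lnm : ln m < 0 by rewrite ln_lt0// m0.
have nR : 0 < n%:R :> R by rewrite ltr0n.
exists (2 / m), (- ln m / (2 * n%:R)); split.
- by rewrite divr_gt0.
- by rewrite divr_gt0 ?mulr_gt0// oppr_gt0.
move=> z0 z1 z f g _ sol t t0.
have rec := wave_recursion SE p1 sol.
have [[lf lg] zE bc _] := sol.
have fgE : {ae mu, forall t, 0 < t -> f t = - g t}.
  apply: (dirichlet_reflection p1 lf lg zE).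
  by apply: (ae_imp bc) => u bcu u0; have [] := bcu u0.
(* [2k] is the last even integer before [t], so that [k / n] blocks of [n] steps
   have been completed; one more block would take the orbit past time [t],
   whence the factor [1 / m] in the first constant. *)
pose k := Num.truncn (t / 2).
pose c := m ^+ (k %/ n).
have c0 : 0 < c by exact: exprn_gt0.
have gk j : (k <= j)%N ->
    {ae mu, forall s, -1 < s < 1 -> `|g (j.*2%:R + s)| <= c * `|g s|}.
  move=> kj; apply: (ae_imp rec) => s gs /andP[s1 _].
  have := @orbit_contraction S m n (fun i => g (i.*2%:R + s)) (ltW m0) n0
    (fun x y => @damping_svmap_le Sigma S x y dS SE) Sn (gs s1) j.
  rewrite add0r => /le_trans; apply; rewrite ler_wpM2r//.
  by rewrite ler_wiXn2l ?(ltW m0) ?(ltW m1)// leq_div2r.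
have k2 : k.*2%:R = 2 * k%:R :> R by rewrite -mul2n natrM.
have /andP[kt tk] : k.*2%:R <= t < k.*2%:R + 2.
  have t20 : 0 <= t / 2 by rewrite divr_ge0.
  have := truncn_itv t20; rewrite -/k => /andP[h1 h2].
  rewrite -[k.+1%:R]natr1 in h2.
  by rewrite k2; apply/andP; split; lra.
have gk2 : {ae mu, forall s, -1 < s < 1 -> `|g (k.*2%:R + 2 + s)| <= c * `|g s|}.
  have -> : k.*2%:R + 2 = k.+1.*2%:R :> R by rewrite doubleS -[k.*2.+2]addn2 natrD.
  exact: gk.
have kt' : k.*2%:R <= t < k.*2%:R + 2 by rewrite kt.
apply: (le_trans (energy_decay p1 lf lg zE fgE (ler0n _ _) kt' c0 (gk k (leqnn k)) gk2)).
apply: lee_wpmul2r; first exact: Xp_norm_ge0.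
rewrite lee_fin -mulrA ler_pM2l// -ler_pdivrMl ?invr_gt0// invrK.
rewrite /c -exprS -[m in m ^+ _]lnK ?posrE// -expRM_natl ler_expR.
have -> : - (- ln m / (2 * n%:R)) * t = ln m * (t / (2 * n%:R)) by ring.
rewrite mulrC ler_nM2l// ler_pdivrMr ?mulr_gt0//.
have : k.+1%:R <= (k %/ n).+1%:R * n%:R :> R.
  by rewrite -natrM ler_nat ltn_ceil.
rewrite -[k.+1%:R]natr1 => kq.
by move: tk; rewrite k2; lra.
Qed.

End Sufficiency.

(** * From exponential decay to contraction *)

Section StepFunction.
Context {R : realType}.
Notation mu := (@lebesgue_measure R).

(** The function equal to [a k] on [[2k - 1, 2k + 1)]; the truncation to a natural
    number gives it the value [a 0] to the left of [-1]. *)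
Definition step_fun (a : nat -> R) (s : R) : R := a (Num.truncn ((s + 1) / 2)).

Lemma step_funE (a : nat -> R) (k : nat) (s : R) :
  k.*2%:R - 1 <= s < k.*2%:R + 1 -> step_fun a s = a k.
Proof.
move=> /andP[h1 h2]; congr (a _); apply: truncn_def.
rewrite -[k.+1%:R]natr1; move: h1 h2; rewrite -mul2n natrM => h1 h2.
by apply/andP; split; lra.
Qed.

Lemma step_fun_shift (a : nat -> R) (s : R) : -1 <= s ->
  step_fun a s = a (Num.truncn ((s + 1) / 2)) /\
  step_fun a (s + 2) = a (Num.truncn ((s + 1) / 2)).+1.
Proof.
move=> s1; split=> //; congr (a _); apply: truncn_def.
have s0 : 0 <= (s + 1) / 2 by lra.
have := truncn_itv s0; set k := Num.truncn _ => /andP[h1 h2].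
rewrite -[k.+2%:R]natr1; move: h2; rewrite -[k.+1%:R]natr1 => h2.
by apply/andP; split; lra.
Qed.

(** Each step is an interval, because the truncation is monotone. *)
Lemma measurable_step_fun (a : nat -> R) : measurable_fun setT (step_fun a).
Proof.
move=> _ Y mY; rewrite setTI.
have -> : step_fun a @^-1` Y = \bigcup_(n in [set n | Y (a n)])
    [set s | Num.truncn ((s + 1) / 2) = n].
  by apply/seteqP; split => [s Ys|s [n /= Yn sn]]; [exists (Num.truncn ((s + 1) / 2))|rewrite /= /step_fun sn].
apply: bigcup_measurable => n _; apply: is_interval_measurable.
have mono (x y : R) : x <= y -> (Num.truncn ((x + 1) / 2) <= Num.truncn ((y + 1) / 2))%N.
  by move=> xy; apply: le_truncn; lra.
move=> x y /= xn yn s /andP[xs sy]; apply/eqP; rewrite eqn_leq.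
by apply/andP; split; [rewrite -yn|rewrite -xn]; exact: mono.
Qed.

Lemma bounded_Lp (p : \bar R) (b c M : R) (h : R -> R) : (1 <= p)%E ->
  measurable_fun setT h -> 0 <= M -> (forall x, b < x < c -> `|h x| <= M) ->
  Lp p `]b, c[ h.
Proof.
move=> p1 mh M0 hM; rewrite /Lp inE; apply/andP; split; rewrite inE/=.
  by apply/(measurable_restrictT _ _).1 => //; exact: measurable_funTS.
rewrite /finite_norm; case: p p1 => [r||//] p1.
  have r1 : 1 <= r by [].
  have r0 : 0 < r by exact: lt_le_trans r1.
  rewrite unlock /=; apply: poweR_lty.
  apply: (@le_lt_trans _ _ (\int[mu]_(x in `]b, c[) (M `^ r)%:E)%E).
    rewrite [leRHS]integral_mkcond; apply: ge0_le_integral => //.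
    - apply/measurable_EFinP; apply: measurable_norm_powR.
      by apply/(measurable_restrictT _ _).1 => //; exact: measurable_funTS.
    - by apply/(measurable_restrictT _ _).1.
    - move=> x _; rewrite !patchE; case: ifPn => [|_]; last first.
        by rewrite normr0 powR0 ?gt_eqF.
      rewrite inE/= in_itv/= => xbc; rewrite lee_fin.
      by apply: ge0_ler_powR; rewrite ?nnegrE ?(ltW r0)//; exact: hM.
  rewrite integral_cst//= lebesgue_measure_itv/=; case: ifP => _.
    by rewrite -EFinB -EFinM ltry.
  by rewrite mule0 ltry.
apply: (@le_lt_trans _ _ M%:E); last exact: ltry.
apply/Lnorm_pinfty_le; split=> //; apply: aeW => x /=.
by rewrite in_itv/=; exact: hM.
Qed.

End StepFunction.

Section StepWave.
Context {R : realType}.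
Notation mu := (@lebesgue_measure R).

Lemma rotation_inj : injective (@rotation R).
Proof.
move=> [x1 x2] [y1 y2] [] e1 e2.
have s0 : (Num.sqrt 2)^-1 != 0 :> R by rewrite invr_eq0 gt_eqF// sqrtr_gt0.
move/(mulIf s0) : e1; move/(mulIf s0) : e2 => /= e2 e1.
by congr (_, _); lra.
Qed.

Lemma step_integral (a : nat -> R) (k : nat) (r : R) :
  (\int[mu]_(x in `](k.*2%:R - 1)%R, (k.*2%:R + 1)%R[) (`|step_fun a x| `^ r)%:E =
   (`|a k| `^ r * 2)%:E)%E.
Proof.
transitivity (\int[mu]_(x in `](k.*2%:R - 1)%R, (k.*2%:R + 1)%R[) (`|a k| `^ r)%:E)%E.
  apply: eq_integral => x; rewrite inE/= in_itv/= => /andP[x1 x2].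
  by rewrite (@step_funE _ a k)// x2 (ltW x1).
rewrite integral_cst//= lebesgue_measure_itv/= lte_fin ifT; last lra.
by rewrite -EFinB -EFinM; congr (_ * _)%:E; lra.
Qed.

Lemma step_fun0E (a : nat -> R) (s : R) : -1 <= s < 1 -> step_fun a s = a 0%N.
Proof. by move=> s1; apply: step_funE; rewrite !add0r. Qed.

Lemma step_primitive0 (a : nat -> R) (x : R) : 0 < x < 1 ->
  primitive0 (step_fun a) x = a 0%N * x /\
  primitive0 (step_fun a) (- x) = - (a 0%N * x).
Proof.
move=> /andP[x0 x1].
have cst (b c : R) : -1 <= b -> b < c -> c < 1 ->
    \int[mu]_(s in `[b, c]) step_fun a s = a 0%N * (c - b).
  move=> b1 bc c1; transitivity (\int[mu]_(s in `[b, c]) a 0%N).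
    apply: eq_Rintegral => s; rewrite inE/= in_itv/= => /andP[bs sc].
    by rewrite step_fun0E// (le_trans b1)// (le_lt_trans sc).
  by rewrite Rintegral_cst//= lebesgue_measure_itv/= lte_fin bc.
rewrite /primitive0 (ltW x0) leNgt oppr_lt0 x0/=; split.
  by rewrite cst ?subr0//; lra.
by rewrite cst ?sub0r ?opprK//; lra.
Qed.

Lemma Lploc_step (p : \bar R) (b M : R) (a : nat -> R) : (1 <= p)%E ->
  (forall i, `|a i| <= M) -> Lploc p b (step_fun a).
Proof.
move=> p1 aM; split; first by apply: measurable_funTS; exact: measurable_step_fun.
move=> T _; apply: (@bounded_Lp _ _ _ _ M) => //; first exact: measurable_step_fun.
  exact: le_trans (aM 0%N).
by move=> x _; exact: aM.
Qed.

Lemma primitive0N (h : R -> R) (t : R) :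
  mu.-integrable `[0, t] (EFin \o h) -> 0 <= t ->
  primitive0 (fun s => - h s) t = - primitive0 h t.
Proof.
move=> ih t0; rewrite /primitive0 t0 -mulN1r -RintegralZl//.
by apply: eq_Rintegral => s _; rewrite mulN1r.
Qed.

Definition step_wave (a : nat -> R) (t x : R) : R :=
  (Num.sqrt 2)^-1 * primitive0 (fun s => - step_fun a s) (t + x) +
  (Num.sqrt 2)^-1 * primitive0 (step_fun a) (t - x).

Lemma step_fun_integrable (a : nat -> R) (M t : R) : (forall i, `|a i| <= M) ->
  mu.-integrable `[0, t] (EFin \o step_fun a).
Proof.
move=> aM; apply: measurable_bounded_integrable => //.
- by rewrite /= lebesgue_measure_itv/=; case: ifP => _; rewrite ?ltry// -EFinB ltry.
- by apply: measurable_funTS; exact: measurable_step_fun.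
- exists M; split; first exact: num_real.
  by move=> N MN s _ /=; rewrite (le_trans (aM _))// ltW.
Qed.

(** On (-1, 1) the step function is the constant [a 0], so that the initial
    position is linear and the initial velocity vanishes. *)
Lemma step_wave_initial (a : nat -> R) (M : R) :
  (forall i, `|a i| <= M) ->
  {ae mu, forall x, 0 <= x <= 1 ->
    step_wave a 0 x = - Num.sqrt 2 * a 0%N * x /\
    wave_t (fun s => - step_fun a s) (step_fun a) 0 x = 0}.
Proof.
move=> aM; apply: (ae_imp2 (ae_neq 0) (ae_neq 1)) => x x0 x1 /andP[x0' x1'].
have x01 : 0 < x < 1 by rewrite !lt_neqAle eq_sym x0 x0' x1 x1'.
have /andP[xp xl] := x01.
have s0 : Num.sqrt 2 != 0 :> R by rewrite gt_eqF// sqrtr_gt0.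
have s2 : Num.sqrt 2 * Num.sqrt 2 = 2 :> R by rewrite -expr2 sqr_sqrtr.
split.
  rewrite /step_wave add0r sub0r primitive0N//; last exact: step_fun_integrable.
  have [-> ->] := step_primitive0 a x01.
  by apply: (mulfI s0); rewrite mulrDr !mulrA divff// !mul1r mulrN s2; ring.
rewrite /wave_t add0r sub0r !step_fun0E ?addNr ?mul0r//; lra.
Qed.

Lemma Xp_linear (p : \bar R) (c : R) : (1 <= p)%E ->
  Xp p (fun x => c * x, fun=> 0).
Proof.
move=> p1.
have ml : measurable_fun setT (fun x : R => c * x) by exact: measurable_funM.
split=> /=; last first.
  by apply: (@bounded_Lp _ _ _ _ 0) => // x _; rewrite normr0.
split; rewrite ?mulr0//.
- apply: (@bounded_Lp _ _ _ _ `|c|) => // x /andP[x0 x1].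
  by rewrite normrM ler_piMr// ger0_norm ltW.
- exists (fun=> c); split; last by apply: (@bounded_Lp _ _ _ _ `|c|).
  apply: (@is_weak_deriv_primitive _ _ _ 0).
    apply: (@measurable_bounded_integrable _ _ _ mu (cst c)) => //.
      by rewrite /= lebesgue_measure_itv/= lte_fin ltr01 -EFinB ltry.
    by exists `|c|; split; [exact: num_real|move=> N cN x _ /=; exact: ltW].
  move=> x /andP[x0 _]; rewrite Rintegral_cst//= lebesgue_measure_itv/= lte_fin x0.
  by rewrite /= subr0 add0r.
- apply: continuous_subspaceT => x; apply: cvgM; first exact: cvg_cst.
  exact: cvg_id.
Qed.

Lemma step_wave_solution (Sigma : set (R * R)) (p : \bar R) (S : R -> set R)
    (a : nat -> R) (M : R) :
  (1 <= p)%E -> svmap_graph S = rotation @` Sigma ->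
  (forall i, `|a i| <= M) -> (forall i, S (a i) (a i.+1)) ->
  wave_solution_by Sigma p (fun x => - Num.sqrt 2 * a 0%N * x) (fun=> 0)
    (step_wave a) (fun s => - step_fun a s) (step_fun a).
Proof.
move=> p1 SE aM aS; split.
- split; last exact: Lploc_step aM.
  have -> : (fun s => - step_fun a s) = step_fun (fun i => - a i) by [].
  by apply: (@Lploc_step _ _ M (fun i => - a i)) => // i; rewrite normrN.
- by [].
- apply: aeW => t t0; split.
    rewrite /step_wave addr0 subr0 primitive0N//; last exact: step_fun_integrable aM.
    by rewrite mulrN addNr.
  have t1 : -1 <= t - 1 by lra.
  have [e1 e2] := step_fun_shift a t1.
  have e3 : t - 1 + 2 = t + 1 by ring.
  rewrite e3 in e2.
  have : svmap_graph S (step_fun a (t - 1), step_fun a (t + 1)).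
    by rewrite e1 e2; exact: aS.
  rewrite SE => -[xi Sxi xiE].
  suff -> : (wave_t (fun s => - step_fun a s) (step_fun a) t 1,
      - wave_x (fun s => - step_fun a s) (step_fun a) t 1) = xi by [].
  by apply: rotation_inj; rewrite rotation_wave xiE opprK.
- exact: step_wave_initial aM.
Qed.

End StepWave.

Section Necessity.
Context {R : realType}.
Notation mu := (@lebesgue_measure R).

(** At time [2k] the window of the energy is a single step, so that the energy is
    [|a k|] times [2 ^ (1 / p)], and the factor cancels out. *)
Lemma step_energy_le (p : \bar R) (a : nat -> R) (M m : R) (n : nat) :
  (1 <= p)%E -> (forall i, `|a i| <= M) -> 0 <= m ->
  (energy p (step_wave a) (fun s => - step_fun a s)%R (step_fun a) n.*2%:R <=
   m%:E * energy p (step_wave a) (fun s => - step_fun a s)%R (step_fun a) 0)%E ->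
  `|a n| <= m * `|a 0%N|.
Proof.
move=> p1 aM m0.
have lg := Lploc_step (-1) p1 aM.
have lf : Lploc p 0 (fun s => - step_fun a s)%R.
  by apply: (@Lploc_step _ _ _ M (fun i => - a i)) => // i; rewrite normrN.
have zE t x : 0 <= t -> 0 <= x <= 1 -> step_wave a t x =
    (Num.sqrt 2)^-1 * primitive0 (fun s => - step_fun a s)%R (t + x) +
    (Num.sqrt 2)^-1 * primitive0 (step_fun a) (t - x) by [].
have fgE : {ae mu, forall t, 0 < t -> - step_fun a t = - step_fun a t} by exact: aeW.
have n0 : 0 <= n.*2%:R :> R by [].
case: p p1 lf lg => [r||//] p1 lf lg.
  have r1 : 1 <= r by [].
  have r0 : 0 < r by exact: lt_le_trans r1.
  rewrite (energy_finE p1 lf lg zE fgE n0 r1) (energy_finE p1 lf lg zE fgE (lexx 0) r1).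
  have root_scale (w : R) : 0 <= w -> (w `^ r * 2) `^ r^-1 = w * 2 `^ r^-1.
    by move=> w0; rewrite powRM ?powR_ge0// -powRrM divff ?gt_eqF// powRr1.
  rewrite step_integral.
  have := step_integral a 0 r; rewrite /= => ->.
  have -> : (m%:E * ((`|a 0%N| `^ r * 2)%:E `^ r^-1) =
      (((m * `|a 0%N|) `^ r * 2)%:E `^ r^-1))%E.
    by rewrite !poweR_EFin -EFinM !root_scale ?mulr_ge0// mulrA.
  by rewrite !poweR_EFin !root_scale ?mulr_ge0// lee_fin ler_pM2r// powR_gt0.
have e0 : (energy +oo (step_wave a) (fun s => - step_fun a s)%R (step_fun a) 0 <=
    `|a 0%N|%:E)%E.
  apply/(energy_pinfty_le p1 lf lg zE fgE (lexx 0)); split => //.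
  apply: aeW => x; rewrite sub0r add0r => /andP[x0 x1].
  by rewrite step_fun0E// (ltW x0).
move=> en; have {en} : (energy +oo (step_wave a) (fun s => - step_fun a s)%R (step_fun a) n.*2%:R <=
    (m * `|a 0%N|)%:E)%E.
  by apply: (le_trans en); rewrite EFinM lee_wpmul2l.
move=> /(energy_pinfty_le p1 lf lg zE fgE n0)[_ aen].
have [|x /andP[x1 x2]] := @ae_exists_itv R (n.*2%:R - 1) (n.*2%:R + 1) _ _ aen.
  by lra.
by rewrite (@step_funE _ a n) ?x1 ?x2 ?(ltW x1)//; apply.
Qed.

Theorem contraction_of_GES (Sigma : set (R * R)) (p : \bar R) (S : R -> set R) :
  damping_set Sigma -> (1 <= p)%E -> svmap_graph S = rotation @` Sigma ->
  GES Sigma p -> exists (m : R) (n : nat), [/\ 0 < m < 1, (1 <= n)%N &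
    forall x, (set_norm (svmap_iter S n x) <= (m * `|x|)%:E)%E].
Proof.
move=> [_ dS [phi [_ _ phiS]]] p1 SE [C1 [C2 [C10 C20 decay]]].
have Sphi x : S x (phi x).
  by have := phiS x; rewrite -SE.
(* Chosen so that [C1 < 1 + 2 * C2 * n <= exp (2 * C2 * n)]. *)
pose n := (Num.truncn (C1 / (2 * C2))).+1.
pose m := C1 * expR (- C2 * n.*2%:R).
have m0 : 0 < m by rewrite mulr_gt0 ?expR_gt0.
have m1 : m < 1.
  rewrite /m mulNr expRN -ltr_pdivlMr ?invr_gt0 ?expR_gt0// invrK mul1r.
  apply: (@lt_le_trans _ _ (1 + C2 * n.*2%:R)); last exact: expR_ge1Dx.
  have := truncnS_gt (C1 / (2 * C2)); rewrite -/n ltr_pdivrMr ?mulr_gt0// => C1n.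
  by rewrite -mul2n natrM; lra.
exists m, n; split => //; first by rewrite m0.
move=> x; apply: ge_ereal_sup => _ [y [s [s0 sn Ss]] <-]; rewrite lee_fin.
(* A solution must be global in time: the given piece of orbit is continued
   with the selection [phi]. *)
pose a i := if (i <= n)%N then s i else iter (i - n) phi (s n).
have aS i : S (a i) (a i.+1).
  rewrite /a; have [ni|ni|<-] := ltngtP i n.
  - exact: Ss.
  - by rewrite subSn ?(ltnW ni)//= ; exact: Sphi.
  - by rewrite subSnn /=; exact: Sphi.
have aM i : `|a i| <= `|a 0%N|.
  elim: i => // i IH; apply: le_trans IH.
  exact: (damping_svmap_le dS SE (aS i)).
have := decay _ _ _ _ _ (Xp_linear (- Num.sqrt 2 * a 0%N) p1)
  (step_wave_solution p1 SE aM aS) _ (ler0n _ n.*2).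
move=> /(step_energy_le p1 aM (ltW m0)).
by rewrite /a leqnn sn /= s0.
Qed.

End Necessity.

Theorem corollary58 (R : realType) (Sigma : set (R * R)) (p : \bar R)
    (S : R -> set R)
    (hSigma : damping_set Sigma) (hp : (1%:E <= p)%E)
    (hS : svmap_graph S = rotation @` Sigma) :
  GES Sigma p <->
  exists (mu : R) (n0 : nat),
    [/\ 0 < mu < 1, (1 <= n0)%N &
        forall x : R, (set_norm (svmap_iter S n0 x) <= (mu * `|x|)%:E)%E].
Proof.
split; first exact: contraction_of_GES.
by move=> [m [n [m01 n1 Sn]]]; exact: GES_of_contraction Sn.
Qed.
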